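(* Consider the two-user state-dependent discrete memoryless broadcast channel $\mathrm{C}_1$ (Class I) with finite alphabets $\mathcal{W},\mathcal{X},\mathcal{Y}_1,\mathcal{Y}_2$, state distribution $p(w)$, transition law $p(y_1,y_2|x,w)$, and the state sequence known noncausally at the encoder. Let $\mathcal{C}_1$ be its capacity region. Let $\mathcal{P}_1$ be the set of all joint distributions $p_1$ of $(W,V_1,V_2,X,Y_1,Y_2)$, with auxiliary random variables $V_1\in\mathcal{V}_1$, $V_2\in\mathcal{V}_2$ on finite sets, of the form $$p(w)\,p(v_1,v_2|w)\,p(x|w,v_1,v_2)\,p(y_1,y_2|x,w)$$ (so that $(V_1,V_2)\to(X,W)\to(Y_1,Y_2)$ is a Markov chain). For $p_1\in\mathcal{P}_1$ let $\mathcal{R}_{1,\mathrm{in}}(p_1)$ be the convex hull of the set of all rate pairs $(R_1,R_2)$, $R_1,R_2\ge 0$, satisfying simultaneously $$R_1\le I(V_1;Y_1)-I(V_1;W),$$ $$R_2\le I(V_2;Y_2)-I(V_2;W),$$ $$R_1+R_2\le I(V_1;Y_1)+I(V_2;Y_2)-I(V_1;V_2)-I(V_1,V_2;W).$$ Let $\mathcal{R}_{1,\mathrm{in}}=\bigcup_{p_1\in\mathcal{P}_1}\mathcal{R}_{1,\mathrm{in}}(p_1)$. Then $\mathcal{R}_{1,\mathrm{in}}\subseteq\mathcal{C}_1$.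
   Context: Channel model. A sender communicates over $\mathrm{N}$ channel uses with two non-cooperating receivers $\mathrm{D}_1,\mathrm{D}_2$. The state sequence $\mathbf{W}=(W_1,\dots,W_{\mathrm{N}})$ is i.i.d. $\sim p(w)$ and independent of the messages; the channel is memoryless: $p(\mathbf{y}_1,\mathbf{y}_2|\mathbf{x},\mathbf{w})=\prod_{n=1}^{\mathrm{N}}p(y_{1,n},y_{2,n}|x_n,w_n)$. The messages $M_t$, $t=1,2$, are independent and uniform on $\mathcal{M}_t=\{1,\dots,2^{\mathrm{N}R_t}\}$ ($2^{\mathrm{N}R_t}$ is treated as an integer without loss of generality). Codes for $\mathrm{C}_1$. A $((2^{\mathrm{N}R_1},2^{\mathrm{N}R_2}),\mathrm{N},P_e^{(\mathrm{N})})$ code consists of a deterministic encoder $\mathbf{X}=\mathbf{f}(m_1,m_2,\mathbf{W})\in\mathcal{X}^{\mathrm{N}}$, which uses the entire state sequence (noncausal side-information), and decoders $g_t:\mathcal{Y}_t^{\mathrm{N}}\to\mathcal{M}_t$, $t=1,2$. The error probability is $P_e^{(\mathrm{N})}=\max\{P_{e,1}^{(\mathrm{N})},P_{e,2}^{(\mathrm{N})}\}$, where $P_{e,t}^{(\mathrm{N})}=\Pr[g_t(\mathbf{Y}_t)\neq M_t]$, averaged over the uniform messages and the state sequence. Capacity region. $(R_1,R_2)$ is achievable if there is a sequence of such codes with $P_e^{(\mathrm{N})}\to0$ as $\mathrm{N}\to\infty$. $\mathcal{C}_1$ is the closure of the set of achievable rate pairs. *)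

(* Defs.v *)
From HB Require Import structures.
From mathcomp Require Import all_boot all_order all_algebra.
From mathcomp Require Import all_classical all_reals all_analysis.

Set Implicit Arguments.
Unset Strict Implicit.
Unset Printing Implicit Defensive.

Import Order.TTheory GRing.Theory Num.Theory.
Import numFieldNormedType.Exports.

Local Open Scope classical_set_scope.
Local Open Scope ring_scope.

Record fdist (R : realType) (T : finType) := FDist {
  pmf :> T -> R ;
  pmf_ge0 : forall t, 0 <= pmf t ;
  pmf_sum1 : \sum_t pmf t = 1 }.

Section InformationMeasures.
Variables (R : realType) (T : finType).

Definition Pr (p : T -> R) (E : pred T) : R := \sum_(t | E t) p t.

Definition log2 (x : R) : R := ln x / ln 2.

(* The convention 0 log 0 = 0 is automatic: if P(A = a, B = b) = 0, the
   summand vanishes whatever value the (total) logarithm and division take. *)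
Definition mutual_info (p : T -> R) (S U : finType) (A : T -> S) (B : T -> U)
    : R :=
  \sum_(a : S) \sum_(b : U)
    let pab := Pr p (fun t => (A t == a) && (B t == b)) in
    pab * log2 (pab / (Pr p (fun t => A t == a) * Pr p (fun t => B t == b))).

End InformationMeasures.

(* [trans_law C x w (y1, y2)] is p(y1, y2 | x, w). *)
Record channel (R : realType) (W X Y1 Y2 : finType) := Channel {
  state_law : fdist R W ;
  trans_law : X -> W -> fdist R (Y1 * Y2)%type }.

Definition convex_hull (R : realType) (A : set (R * R)) : set (R * R) :=
  smallest (@convex_set R (R^o * R^o)%type) A.

Section CapacityRegion.
Variables (R : realType) (W X Y1 Y2 : finType) (C : channel R W X Y1 Y2).

(* The encoder sees the whole state sequence: each letter of the codeword may
   depend on past, present and future states. *)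
Record code (M1 M2 N : nat) := Code {
  enc : 'I_M1 -> 'I_M2 -> {ffun 'I_N -> W} -> {ffun 'I_N -> X} ;
  dec1 : {ffun 'I_N -> Y1} -> 'I_M1 ;
  dec2 : {ffun 'I_N -> Y2} -> 'I_M2 }.

Definition outcome (M1 M2 N : nat) : finType :=
  ('I_M1 * 'I_M2 * {ffun 'I_N -> W} * {ffun 'I_N -> Y1} * {ffun 'I_N -> Y2})%type.

Definition code_law M1 M2 N (c : code M1 M2 N) (o : outcome M1 M2 N) : R :=
  let: (m1, m2, w, y1, y2) := o in
  M1%:R^-1 * M2%:R^-1 * (\prod_(n < N) state_law C (w n)) *
  \prod_(n < N) trans_law C (enc c m1 m2 w n) (w n) (y1 n, y2 n).

Definition error1 M1 M2 N (c : code M1 M2 N) : R :=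
  Pr (code_law c) (fun o => let: (m1, _, _, y1, _) := o in dec1 c y1 != m1).

Definition error2 M1 M2 N (c : code M1 M2 N) : R :=
  Pr (code_law c) (fun o => let: (_, m2, _, _, y2) := o in dec2 c y2 != m2).

Definition error_prob M1 M2 N (c : code M1 M2 N) : R :=
  Num.max (error1 c) (error2 c).

(* Number of messages at rate r: 2^(N r), rounded up to an integer. *)
Definition nmsg (N : nat) (r : R) : nat := `|Num.ceil (2 `^ (N%:R * r))|%N.

Definition achievable : set (R * R) := [set r |
  [/\ 0 <= r.1, 0 <= r.2 &
    exists c : forall N : nat, code (nmsg N r.1) (nmsg N r.2) N,
      error_prob (c N) @[N --> \oo] --> (0 : R)]].

Definition capacity_region : set (R * R) := closure achievable.

End CapacityRegion.

Section InnerBound.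
Variables (R : realType) (W X Y1 Y2 : finType) (C : channel R W X Y1 Y2).

Section FixedAuxiliaries.
Variables V1 V2 : finType.

Definition sample : finType := (W * V1 * V2 * X * Y1 * Y2)%type.

Definition rvW (s : sample) : W := let: (w, _, _, _, _, _) := s in w.
Definition rvV1 (s : sample) : V1 := let: (_, v1, _, _, _, _) := s in v1.
Definition rvV2 (s : sample) : V2 := let: (_, _, v2, _, _, _) := s in v2.
Definition rvV12 (s : sample) : V1 * V2 := (rvV1 s, rvV2 s).
Definition rvY1 (s : sample) : Y1 := let: (_, _, _, _, y1, _) := s in y1.
Definition rvY2 (s : sample) : Y2 := let: (_, _, _, _, _, y2) := s in y2.

(* The kernels [qV] and [qX] are p(v1, v2 | w) and p(x | w, v1, v2). *)
Definition P1 : set (fdist R sample) := [set p |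
  exists (qV : W -> fdist R (V1 * V2)%type)
         (qX : W -> V1 -> V2 -> fdist R X),
  forall w v1 v2 x y1 y2,
    p (w, v1, v2, x, y1, y2) =
    state_law C w * qV w (v1, v2) * qX w v1 v2 x * trans_law C x w (y1, y2)].

Definition rate_constraints (p : fdist R sample) : set (R * R) := [set r |
  let I S U := @mutual_info R sample p S U in
  [/\ 0 <= r.1, 0 <= r.2,
      r.1 <= I _ _ rvV1 rvY1 - I _ _ rvV1 rvW,
      r.2 <= I _ _ rvV2 rvY2 - I _ _ rvV2 rvW &
      r.1 + r.2 <= I _ _ rvV1 rvY1 + I _ _ rvV2 rvY2
                   - I _ _ rvV1 rvV2 - I _ _ rvV12 rvW]].

Definition R1in_at (p : fdist R sample) : set (R * R) :=
  convex_hull (rate_constraints p).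

End FixedAuxiliaries.

Definition R1in : set (R * R) := [set r |
  exists (V1 V2 : finType) (p : fdist R (sample V1 V2)), P1 p /\ R1in_at p r].

End InnerBound.

(* Main.v *)
Require Import Defs.
From HB Require Import structures.
From mathcomp Require Import all_boot all_order all_algebra.
From mathcomp Require Import all_classical all_reals all_analysis.
From mathcomp Require Import ring lra.
(* all_analysis exports another [pmf]. *)
Import Defs.

(* The set cut out by the rate constraints is already convex, so no time sharing
   is needed.  Random coding: each message of user t owns a bin of J_t codewords
   drawn i.i.d. from p(v_t).  Given (m1, m2, w), the encoder picks in the two
   bins the pair of codewords, together with the channel input, minimising the
   conditional probability that some decoder's threshold test fails on its own
   codeword.  That minimum is at most any weighted average over the bins;
   weighting by the truncated likelihood ratio p(v1, v2 | w) / (p(v1) p(v2)), it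
   is controlled by a second moment computation as soon as J1 beats I(V1; W),
   J2 beats I(V2; W) and J1 J2 beats I(V1; V2) + I(V1, V2; W).  Codewords of
   other messages are independent of the output, so a union bound handles
   confusions as soon as M_t J_t stays below I(V_t; Y_t).  The weak law of large
   numbers turns these one-shot bounds into rates, and eliminating the bin rates
   leaves the stated region. *)

Set Implicit Arguments.
Unset Strict Implicit.
Unset Printing Implicit Defensive.

Import Order.TTheory GRing.Theory Num.Theory.
Import numFieldNormedType.Exports.

Local Open Scope classical_set_scope.
Local Open Scope ring_scope.

(** * Expectations and product measures *)

Definition Ex (R : realType) (T : finType) (p : fdist R T) (f : T -> R) : R :=
  \sum_t p t * f t.

Section Expectation.
Variables (R : realType) (T : finType) (p : fdist R T).
Implicit Types (f g : T -> R) (a : R) (E F : pred T).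

Lemma pmf_gt0 t : (0 < p t) = (p t != 0).
Proof. by rewrite lt0r pmf_ge0 andbT. Qed.

Lemma eq_Ex f g : f =1 g -> Ex p f = Ex p g.
Proof. by move=> fg; apply: eq_bigr => t _; rewrite fg. Qed.

Lemma eq_Ex_supp f g : (forall t, 0 < p t -> f t = g t) -> Ex p f = Ex p g.
Proof.
move=> fg; apply: eq_bigr => t _.
have [-> |pt] := eqVneq (p t) 0; first by rewrite !mul0r.
by rewrite fg // pmf_gt0.
Qed.

Lemma Ex_cst a : Ex p (fun=> a) = a.
Proof. by rewrite /Ex -mulr_suml pmf_sum1 mul1r. Qed.

Lemma ExD f g : Ex p (fun t => f t + g t) = Ex p f + Ex p g.
Proof. by rewrite /Ex -big_split; apply: eq_bigr => t _; rewrite mulrDr. Qed.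

Lemma ExZ a f : Ex p (fun t => a * f t) = a * Ex p f.
Proof. by rewrite /Ex mulr_sumr; apply: eq_bigr => t _; rewrite mulrCA. Qed.

Lemma ExZr a f : Ex p (fun t => f t * a) = Ex p f * a.
Proof. by rewrite /Ex mulr_suml; apply: eq_bigr => t _; rewrite mulrA. Qed.

Lemma ExN f : Ex p (fun t => - f t) = - Ex p f.
Proof. by rewrite /Ex -sumrN; apply: eq_bigr => t _; rewrite mulrN. Qed.

Lemma Ex_sum (I : Type) (r : seq I) (Q : pred I) (F : I -> T -> R) :
  Ex p (fun t => \sum_(i <- r | Q i) F i t) = \sum_(i <- r | Q i) Ex p (F i).
Proof.
by rewrite /Ex exchange_big; apply: eq_bigr => t _; rewrite mulr_sumr.
Qed.

Lemma Ex_exchange (U : finType) (q : fdist R U) (h : T -> U -> R) :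
  Ex p (fun t => Ex q (h t)) = Ex q (fun u => Ex p (h ^~ u)).
Proof. by rewrite [LHS]Ex_sum; apply: eq_bigr => u _; rewrite ExZ. Qed.

Lemma le_Ex f g : (forall t, 0 < p t -> f t <= g t) -> Ex p f <= Ex p g.
Proof.
move=> fg; apply: ler_sum => t _.
have [-> |pt] := eqVneq (p t) 0; first by rewrite !mul0r.
have p0 : 0 < p t by rewrite pmf_gt0.
by rewrite ler_pM2l // fg.
Qed.

Lemma Ex_ge0 f : (forall t, 0 < p t -> 0 <= f t) -> 0 <= Ex p f.
Proof. by move=> f0; rewrite -(Ex_cst 0); apply: le_Ex. Qed.

Lemma Ex_le1 f : (forall t, 0 < p t -> f t <= 1) -> Ex p f <= 1.
Proof. by move=> f1; rewrite -(Ex_cst 1); apply: le_Ex. Qed.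

Lemma fdist_supp : exists t, 0 < p t.
Proof.
apply: contrapT => no; have := pmf_sum1 p.
rewrite big1 => [/esym/eqP|t _]; first by rewrite oner_eq0.
by apply/eqP; apply: contra_notT no; rewrite -pmf_gt0; exists t.
Qed.

(** Derandomisation: if [f] exceeded [a] everywhere, a point of positive mass would push the mean
    strictly above [a]. This extracts a fixed codebook from a random one. *)
Lemma Ex_attained f a : Ex p f <= a -> exists t, f t <= a.
Proof.
move=> fa; apply: contrapT => no.
have lt t : a < f t by rewrite ltNge; apply/negP => h; apply: no; exists t.
have [t pt] := fdist_supp.
suff : a < Ex p f by rewrite ltNge fa.
rewrite -[X in X < _](Ex_cst a) /Ex (bigD1 t) //= [ltRHS](bigD1 t) //=.
apply: ltr_leD; first by rewrite ltr_pM2l.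
by apply: ler_sum => u _; rewrite ler_wpM2l ?pmf_ge0 // ltW.
Qed.

Lemma Pr_Ex E : Pr p E = Ex p (fun t => (E t)%:R).
Proof.
rewrite /Pr /Ex big_mkcond; apply: eq_bigr => t _.
by case: (E t); rewrite ?mulr1 ?mulr0.
Qed.

Lemma Ex_comp (S : finType) (A : T -> S) (f : S -> R) :
  Ex p (fun t => f (A t)) = \sum_s Pr p (fun t => A t == s) * f s.
Proof.
rewrite /Ex (partition_big A predT) //=; apply: eq_bigr => s _.
by rewrite /Pr mulr_suml; apply: eq_bigr => t /eqP ->.
Qed.

Lemma Ex_comp2 (S U : finType) (A : T -> S) (B : T -> U) (f : S -> U -> R) :
  Ex p (fun t => f (A t) (B t)) =
  \sum_s \sum_u Pr p (fun t => (A t == s) && (B t == u)) * f s u.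
Proof.
rewrite (Ex_comp (fun t => (A t, B t)) (fun z => f z.1 z.2)).
by rewrite pair_bigA; apply: eq_bigr => -[s u] _ /=.
Qed.

Lemma Pr_ge0 E : 0 <= Pr p E.
Proof. by apply: sumr_ge0 => t _; apply: pmf_ge0. Qed.

Lemma Pr_gt0 E t : 0 < p t -> E t -> 0 < Pr p E.
Proof.
move=> pt Et; rewrite /Pr (bigD1 t) //=; apply: ltr_wpDr => //.
by apply: sumr_ge0 => u _; apply: pmf_ge0.
Qed.

End Expectation.

Section ProductMeasure.
Variables (R : realType) (I : finType).

Lemma pprod_ge0 (T : finType) (p : I -> fdist R T) (f : {ffun I -> T}) :
  0 <= \prod_i p i (f i).
Proof. by apply: prodr_ge0 => i _; apply: pmf_ge0. Qed.

Lemma pprod_sum1 (T : finType) (p : I -> fdist R T) :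
  \sum_(f : {ffun I -> T}) \prod_i p i (f i) = 1.
Proof.
by rewrite -(bigA_distr_bigA (fun i t => p i t)) big1 // => i _; rewrite pmf_sum1.
Qed.

Definition prodp (T : finType) (p : I -> fdist R T) : fdist R {ffun I -> T} :=
  FDist (pprod_ge0 p) (pprod_sum1 p).

Lemma prodp_supp (T : finType) (p : I -> fdist R T) f i :
  0 < prodp p f -> 0 < p i (f i).
Proof.
move=> pf; rewrite pmf_gt0; apply/eqP => pi0.
by move: pf; rewrite /= (bigD1 i) //= pi0 mul0r ltxx.
Qed.

Lemma Ex_prodp_prod (T : finType) (p : I -> fdist R T) (F : I -> T -> R) :
  Ex (prodp p) (fun f => \prod_i F i (f i)) = \prod_i Ex (p i) (F i).
Proof.
by rewrite /Ex bigA_distr_bigA; apply: eq_bigr => f _; rewrite -big_split.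
Qed.

Section Coordinates.
Variables (T : finType) (p : fdist R T).

(** [G (f i)] is read as a product over all coordinates with factor 1 off [i]; the factors then
    average independently. *)
Lemma Ex_coord i (G : T -> R) : Ex (prodp (fun=> p)) (fun f => G (f i)) = Ex p G.
Proof.
pose F k t := if k == i then G t else 1.
transitivity (Ex (prodp (fun=> p)) (fun f => \prod_k F k (f k))).
  apply: eq_Ex => f; rewrite (bigD1 i) //= /F eqxx big1 ?mulr1 //.
  by move=> k /negbTE ->.
rewrite (Ex_prodp_prod _ F) (bigD1 i) //= /F eqxx big1 ?mulr1 //.
by move=> k /negbTE ->; rewrite Ex_cst.
Qed.

Lemma Ex_coordM i j (G H : T -> R) : i != j ->
  Ex (prodp (fun=> p)) (fun f => G (f i) * H (f j)) = Ex p G * Ex p H.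
Proof.
move=> ij; pose F k t := if k == i then G t else if k == j then H t else 1.
have jni : (j == i) = false by rewrite eq_sym (negbTE ij).
transitivity (Ex (prodp (fun=> p)) (fun f => \prod_k F k (f k))).
  apply: eq_Ex => f; rewrite (bigD1 i) //= (bigD1 j) 1?eq_sym //= /F !eqxx jni.
  by rewrite big1 ?mulr1 // => k /andP[/negbTE -> /negbTE ->].
rewrite (Ex_prodp_prod _ F) (bigD1 i) //= (bigD1 j) 1?eq_sym //= /F !eqxx jni.
by rewrite big1 ?mulr1 // => k /andP[/negbTE -> /negbTE ->]; rewrite Ex_cst.
Qed.

End Coordinates.

Definition ffzip (S T : finType) (u : {ffun I -> S}) (v : {ffun I -> T}) :
  {ffun I -> S * T} := [ffun i => (u i, v i)].

Lemma sum_ffzip (S T : finType) (F : {ffun I -> S * T} -> R) :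
  \sum_f F f = \sum_u \sum_v F (ffzip u v).
Proof.
rewrite pair_bigA /=; apply: reindex.
exists (fun f : {ffun I -> S * T} => ([ffun i => (f i).1], [ffun i => (f i).2])).
  by move=> [u v] _ /=; congr (_, _); apply/ffunP => i; rewrite !ffunE.
by move=> f _; apply/ffunP => i; rewrite !ffunE -surjective_pairing.
Qed.

Lemma zprod_ge0 (S T : finType) (p : I -> fdist R (S * T)%type)
  (z : {ffun I -> S} * {ffun I -> T}) : 0 <= \prod_i p i (z.1 i, z.2 i).
Proof. by apply: prodr_ge0 => i _; apply: pmf_ge0. Qed.

Lemma zprod_sum1 (S T : finType) (p : I -> fdist R (S * T)%type) :
  \sum_(z : {ffun I -> S} * {ffun I -> T}) \prod_i p i (z.1 i, z.2 i) = 1.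
Proof.
rewrite -[RHS](pprod_sum1 p) sum_ffzip pair_bigA /=.
by apply: eq_bigr => z _; apply: eq_bigr => i _; rewrite ffunE.
Qed.

(** The product law of pairs, carried over to pairs of sequences, so that the block of each receiver
    or auxiliary is a component of its own. *)
Definition zprod (S T : finType) (p : I -> fdist R (S * T)%type) :
  fdist R ({ffun I -> S} * {ffun I -> T})%type :=
  FDist (zprod_ge0 p) (zprod_sum1 p).

End ProductMeasure.

(** * Weak law of large numbers by second moments *)

Section WeakLaw.
Variables (R : realType) (T : finType) (p : fdist R T).

(** Off-diagonal terms factor by independence and vanish because [h] is centred. *)
Lemma Ex_sqr_sum (I : finType) (h : T -> R) : Ex p h = 0 ->
  Ex (prodp (fun=> p)) (fun f : {ffun I -> T} => (\sum_i h (f i)) ^+ 2) =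
  #|I|%:R * Ex p (fun t => h t ^+ 2).
Proof.
move=> h0; transitivity (\sum_(i : I) \sum_(j : I)
    Ex (prodp (fun=> p)) (fun f : {ffun I -> T} => h (f i) * h (f j))).
  under [RHS]eq_bigr do rewrite -Ex_sum.
  rewrite -Ex_sum; apply: eq_Ex => f.
  rewrite expr2 mulr_suml; apply: eq_bigr => i _; by rewrite mulr_sumr.
transitivity (\sum_(i : I) Ex p (fun t => h t ^+ 2)); last first.
  by rewrite big_const iter_addr_0 cardT -cardE mulr_natl.
apply: eq_bigr => i _; rewrite (bigD1 i) //= big1 ?addr0 => [|j ji].
  by rewrite -(Ex_coord p i (fun t => h t ^+ 2)).
by rewrite Ex_coordM 1?eq_sym // h0 mul0r.
Qed.

(** Chebyshev: on the event, the centred sum is at least [N%:R * e], so its square divided by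
    [(N%:R * e) ^+ 2] dominates the indicator. *)
Lemma weak_law (N : nat) (h : T -> R) (mu e : R) : 0 < e -> (0 < N)%N ->
  mu = Ex p h ->
  Pr (prodp (fun=> p)) (fun f : {ffun 'I_N -> T} =>
     N%:R * (mu + e) <= \sum_i h (f i)) <=
  Ex p (fun t => (h t - mu) ^+ 2) / e ^+ 2 * N%:R^-1.
Proof.
move=> e0 N0 hmu; have NR : 0 < N%:R :> R by rewrite ltr0n.
have c0 : Ex p (fun t => h t - mu) = 0 by rewrite ExD Ex_cst hmu subrr.
have := Ex_sqr_sum 'I_N c0; rewrite card_ord => sq.
set V := Ex p (fun t => (h t - mu) ^+ 2) in sq *.
suff le : Pr (prodp (fun=> p)) (fun f : {ffun 'I_N -> T} =>
     N%:R * (mu + e) <= \sum_i h (f i)) * (N%:R * e) ^+ 2 <= N%:R * V.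
  rewrite -(ler_pM2r (exprn_gt0 2 (mulr_gt0 NR e0))); apply: le_trans le _.
  by rewrite le_eqVlt; apply/orP; left; apply/eqP; field; rewrite !gt_eqF.
rewrite -sq Pr_Ex -ExZr; apply: le_Ex => f _.
have -> : \sum_i (h (f i) - mu) = \sum_i h (f i) - N%:R * mu.
  by rewrite big_split /= sumr_const card_ord mulNrn mulr_natl.
have Ne : 0 < N%:R * e by rewrite mulr_gt0.
case: (boolP (N%:R * (mu + e) <= \sum_i h (f i))) => [le |_]; last first.
  by rewrite mul0r sqr_ge0.
rewrite mul1r lerXn2r // ?nnegrE; lra.
Qed.

End WeakLaw.

(** * Mutual covering *)

Section MutualCovering.
Variable R : realType.

(** Diagonal pairs give the second moment of [h], off-diagonal ones factor by independence. The last
    term counts all pairs, diagonal included, which only increases the bound. *)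
Lemma Ex_sqr_sum_le (V : finType) (q : fdist R V) (J : nat) (h : V -> R) :
  (forall v, 0 <= h v) ->
  Ex (prodp (fun=> q)) (fun s : {ffun 'I_J -> V} => (\sum_j h (s j)) ^+ 2) <=
  J%:R * Ex q (fun v => h v ^+ 2) + J%:R ^+ 2 * (Ex q h) ^+ 2.
Proof.
move=> h0; set D := Ex q (fun v => h v ^+ 2).
have -> : J%:R * D + J%:R ^+ 2 * (Ex q h) ^+ 2 =
    \sum_(i < J) \sum_(j < J) ((i == j)%:R * D + Ex q h ^+ 2).
  transitivity (\sum_(i < J) (D + J%:R * Ex q h ^+ 2)).
    by rewrite sumr_const card_ord -[RHS]mulr_natl; ring.
  apply: eq_bigr => i _; rewrite big_split /= sumr_const card_ord mulr_natl.
  congr (_ + _); rewrite (bigD1 i) //= eqxx mul1r big1 ?addr0 // => j.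
  by rewrite eq_sym => /negbTE ->; rewrite mul0r.
apply: (@le_trans _ _ (\sum_(i < J) \sum_(j < J)
    Ex (prodp (fun=> q)) (fun s : {ffun 'I_J -> V} => h (s i) * h (s j)))).
  under [leRHS]eq_bigr do rewrite -Ex_sum.
  rewrite -Ex_sum le_eqVlt; apply/orP; left; apply/eqP; apply: eq_Ex => s.
  by rewrite expr2 mulr_suml; apply: eq_bigr => i _; rewrite mulr_sumr.
apply: ler_sum => i _; apply: ler_sum => j _.
have [<-|ij] := eqVneq i j; last by rewrite Ex_coordM // mul0r add0r.
rewrite (Ex_coord q i (fun v => h v * h v)) mul1r lerDl.
by apply: sqr_ge0.
Qed.

Variables (V1 V2 : finType) (q1 : fdist R V1) (q2 : fdist R V2).
Variables (a : V1 -> V2 -> R) (G12 G1 G2 : R) (J1 J2 : nat).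
Hypotheses (J1_gt0 : (0 < J1)%N) (J2_gt0 : (0 < J2)%N).
Hypotheses (a_ge0 : forall v1 v2, 0 <= a v1 v2)
  (a_le1 : \sum_v1 \sum_v2 a v1 v2 <= 1)
  (aG12 : forall v1 v2, a v1 v2 <= G12 * (q1 v1 * q2 v2))
  (aG1 : forall v1, \sum_v2 a v1 v2 <= G1 * q1 v1)
  (aG2 : forall v2, \sum_v1 a v1 v2 <= G2 * q2 v2).

(** The likelihood ratio of [a] against independent codewords. Where the denominator vanishes,
    [aG12] forces [a] to vanish too, so no mass is lost. *)
Let g v1 v2 := a v1 v2 / (q1 v1 * q2 v2).

Let gE v1 v2 : q1 v1 * q2 v2 * g v1 v2 = a v1 v2.
Proof.
rewrite /g mulrCA; have [q0|q0] := eqVneq (q1 v1 * q2 v2) 0; last first.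
  by rewrite divff // mulr1.
apply/eqP; rewrite q0 mul0r mulr0 eq_le a_ge0 andTb.
by have := aG12 v1 v2; rewrite q0 mulr0.
Qed.

Let g_ge0 v1 v2 : 0 <= g v1 v2.
Proof. by rewrite divr_ge0 ?mulr_ge0 ?pmf_ge0. Qed.

Let Ex_g (f : V1 -> V2 -> R) :
  Ex q1 (fun v1 => Ex q2 (fun v2 => g v1 v2 * f v1 v2)) =
  \sum_v1 \sum_v2 a v1 v2 * f v1 v2.
Proof.
apply: eq_bigr => v1 _; rewrite mulr_sumr; apply: eq_bigr => v2 _.
by rewrite -gE; ring.
Qed.

Let mu := \sum_v1 \sum_v2 a v1 v2.

Let mu_ge0 : 0 <= mu.
Proof. by apply: sumr_ge0 => v1 _; apply: sumr_ge0. Qed.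

Let Ex_mu : Ex q1 (fun v1 => Ex q2 (g v1)) = mu.
Proof.
transitivity (Ex q1 (fun v1 => Ex q2 (fun v2 => g v1 v2 * 1))).
  by apply: eq_Ex => v1; apply: eq_Ex => v2; rewrite mulr1.
rewrite (Ex_g (fun _ _ => 1)).
by apply: eq_bigr => v1 _; apply: eq_bigr => v2 _; rewrite mulr1.
Qed.

Let Ex_mu' : Ex q2 (fun v2 => Ex q1 (g ^~ v2)) = mu.
Proof. by rewrite -Ex_exchange Ex_mu. Qed.

Let sqr_le (x c : R) : 0 <= x -> x <= c -> x ^+ 2 <= c * x.
Proof. by move=> x0 xc; rewrite expr2 ler_wpM2r. Qed.

(** On the support [g] is at most [G12], so its square is at most the absolute value of [G12] times
    [g], and [g] has mean [mu], at most 1. The next two bounds repeat this for the partial averages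
    of [g]. *)
Let G12_moment : Ex q1 (fun v1 => Ex q2 (fun v2 => g v1 v2 ^+ 2)) <= `|G12|.
Proof.
apply: (@le_trans _ _ (`|G12| * mu)); last first.
  by rewrite -[leRHS]mulr1 ler_wpM2l.
rewrite -Ex_mu -ExZ; apply: le_Ex => v1 p1; rewrite -ExZ; apply: le_Ex => v2 p2.
apply: sqr_le => //; apply: le_trans (ler_norm _).
by rewrite ler_pdivrMr // mulr_gt0.
Qed.

Let G1_moment : Ex q1 (fun v1 => Ex q2 (g v1) ^+ 2) <= `|G1|.
Proof.
apply: (@le_trans _ _ (`|G1| * mu)); last by rewrite -[leRHS]mulr1 ler_wpM2l.
rewrite -Ex_mu -ExZ; apply: le_Ex => v1 p1; apply: sqr_le.
  by apply: Ex_ge0.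
apply: le_trans (ler_norm _); rewrite -(ler_pM2l p1) [leRHS]mulrC.
apply: le_trans (aG1 v1); rewrite mulr_sumr; apply: ler_sum => v2 _.
by rewrite mulrA gE.
Qed.

Let G2_moment : Ex q2 (fun v2 => Ex q1 (g ^~ v2) ^+ 2) <= `|G2|.
Proof.
apply: (@le_trans _ _ (`|G2| * mu)); last by rewrite -[leRHS]mulr1 ler_wpM2l.
rewrite -Ex_mu' -ExZ; apply: le_Ex => v2 p2; apply: sqr_le.
  by apply: Ex_ge0.
apply: le_trans (ler_norm _); rewrite -(ler_pM2l p2) [leRHS]mulrC.
apply: le_trans (aG2 v2); rewrite mulr_sumr; apply: ler_sum => v1 _.
by rewrite mulrA [q2 _ * _]mulrC gE.
Qed.

Let Q1 := prodp (fun _ : 'I_J1 => q1).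
Let Q2 := prodp (fun _ : 'I_J2 => q2).
Let S (s1 : {ffun 'I_J1 -> V1}) (s2 : {ffun 'I_J2 -> V2}) :=
  \sum_j1 \sum_j2 g (s1 j1) (s2 j2).

(** The four terms sort the pairs of index pairs by what they share: both indices, only [j1], only
    [j2], or nothing. The bound for one codebook is applied to the second codebook, then to the
    first. *)
Let Ex_S2 : Ex Q1 (fun s1 => Ex Q2 (fun s2 => S s1 s2 ^+ 2)) <=
  J1%:R * J2%:R * `|G12| + J1%:R * J2%:R ^+ 2 * `|G1| + J1%:R ^+ 2 * J2%:R * `|G2|
  + J1%:R ^+ 2 * J2%:R ^+ 2 * mu ^+ 2.
Proof.
apply: (@le_trans _ _ (Ex Q1 (fun s1 =>
    J2%:R * Ex q2 (fun v2 => (\sum_j1 g (s1 j1) v2) ^+ 2) +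
    J2%:R ^+ 2 * (\sum_j1 Ex q2 (g (s1 j1))) ^+ 2))).
  apply: le_Ex => s1 _; rewrite -Ex_sum.
  have := @Ex_sqr_sum_le _ q2 J2 (fun v2 => \sum_j1 g (s1 j1) v2).
  move=> /(_ _)/(le_trans _); apply; last by move=> v2; apply: sumr_ge0.
  by apply: le_Ex => s2 _; rewrite /S exchange_big.
rewrite ExD !ExZ Ex_exchange.
have le1 : Ex q2 (fun v2 => Ex Q1 (fun s1 => (\sum_j1 g (s1 j1) v2) ^+ 2)) <=
    J1%:R * `|G12| + J1%:R ^+ 2 * `|G2|.
  apply: (@le_trans _ _ (Ex q2 (fun v2 => J1%:R * Ex q1 (fun v1 => g v1 v2 ^+ 2)
      + J1%:R ^+ 2 * Ex q1 (g ^~ v2) ^+ 2))).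
    by apply: le_Ex => v2 _; apply: Ex_sqr_sum_le.
  rewrite ExD !ExZ -Ex_exchange.
  by apply: lerD; apply: ler_wpM2l; rewrite ?exprn_ge0.
have le2 : Ex Q1 (fun s1 => (\sum_j1 Ex q2 (g (s1 j1))) ^+ 2) <=
    J1%:R * `|G1| + J1%:R ^+ 2 * mu ^+ 2.
  have := @Ex_sqr_sum_le _ q1 J1 (fun v1 => Ex q2 (g v1)).
  rewrite Ex_mu => /(_ _)/le_trans; apply; first by move=> v; apply: Ex_ge0.
  by apply: lerD => //; apply: ler_wpM2l.
apply: (@le_trans _ _ (J2%:R * (J1%:R * `|G12| + J1%:R ^+ 2 * `|G2|) +
   J2%:R ^+ 2 * (J1%:R * `|G1| + J1%:R ^+ 2 * mu ^+ 2))).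
  by apply: lerD; apply: ler_wpM2l; rewrite ?exprn_ge0.
by rewrite le_eqVlt; apply/orP; left; apply/eqP; ring.
Qed.

Let Ex_slice (f : V1 -> V2 -> R) :
  Ex Q1 (fun s1 => Ex Q2 (fun s2 => \sum_j1 \sum_j2 f (s1 j1) (s2 j2))) =
  J1%:R * J2%:R * Ex q1 (fun v1 => Ex q2 (f v1)).
Proof.
transitivity (Ex Q1 (fun s1 => \sum_(j1 < J1) J2%:R * Ex q2 (f (s1 j1)))).
  apply: eq_Ex => s1; rewrite Ex_sum; apply: eq_bigr => j1 _.
  rewrite Ex_sum; under eq_bigr do rewrite (Ex_coord q2).
  by rewrite sumr_const card_ord mulr_natl.
rewrite Ex_sum.
under eq_bigr do rewrite (Ex_coord q1 _ (fun v1 => J2%:R * Ex q2 (f v1))) ExZ.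
by rewrite sumr_const card_ord -[LHS]mulr_natl mulrA.
Qed.

(* With S the empirical average of the likelihood ratio g over the slice, the
   minimum m is at most 2 avg(g phi) when S >= 1/2, and S < 1/2 has small
   probability by Chebyshev. *)
Lemma mutual_covering (phi : V1 -> V2 -> R)
    (m : {ffun 'I_J1 -> V1} -> {ffun 'I_J2 -> V2} -> R) :
  (forall s1 s2, 0 <= m s1 s2 <= 1) ->
  (forall s1 s2 j1 j2, m s1 s2 <= phi (s1 j1) (s2 j2)) ->
  Ex Q1 (fun s1 => Ex Q2 (m s1)) <=
  2 * (\sum_v1 \sum_v2 a v1 v2 * phi v1 v2) +
  4 * ((1 - mu) + (`|G12| / (J1%:R * J2%:R) + `|G1| / J1%:R + `|G2| / J2%:R)).
Proof.
move=> m01 mphi; set c := (J1%:R * J2%:R : R).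
have p1 : 0 < J1%:R :> R by rewrite ltr0n.
have p2 : 0 < J2%:R :> R by rewrite ltr0n.
have c0 : 0 < c by rewrite mulr_gt0.
pose A (s1 : {ffun 'I_J1 -> V1}) (s2 : {ffun 'I_J2 -> V2}) :=
  \sum_j1 \sum_j2 g (s1 j1) (s2 j2) * phi (s1 j1) (s2 j2).
(* The last bracket is [(S s1 s2 / c - 1) ^+ 2], expanded so that each term can be averaged
   separately. When [S s1 s2 / c < 1/2] it exceeds 1/4, hence the factor 4. *)
have pt s1 s2 : m s1 s2 <= 2 / c * A s1 s2 +
    4 * (c ^- 2 * S s1 s2 ^+ 2 - 2 / c * S s1 s2 + 1).
  have /andP[m0 m1] := m01 s1 s2.
  have mS : m s1 s2 * S s1 s2 <= A s1 s2.
    rewrite mulr_sumr; apply: ler_sum => j1 _.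
    by rewrite mulr_sumr; apply: ler_sum => j2 _; rewrite mulrC ler_wpM2l.
  have mS' : m s1 s2 * (S s1 s2 / c) <= A s1 s2 / c.
    by rewrite mulrA ler_pM2r // invr_gt0.
  have -> : c ^- 2 * S s1 s2 ^+ 2 - 2 / c * S s1 s2 + 1 = (S s1 s2 / c - 1) ^+ 2.
    by field; rewrite gt_eqF.
  have -> : 2 / c * A s1 s2 = 2 * (A s1 s2 / c) by ring.
  have A0 : 0 <= A s1 s2 / c.
    apply: le_trans mS'; rewrite mulr_ge0 // divr_ge0 ?(ltW c0) //.
    by apply: sumr_ge0 => j1 _; apply: sumr_ge0.
  set x := S s1 s2 / c in mS' *; set y := A s1 s2 / c in mS' A0 *.
  have [x2|x2] := leP (1/2) x.
    have : m s1 s2 * (1/2) <= m s1 s2 * x by rewrite ler_wpM2l.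
    by have := sqr_ge0 (x - 1); lra.
  by nra.
apply: (@le_trans _ _ (2 / c * (c * (\sum_v1 \sum_v2 a v1 v2 * phi v1 v2)) +
  4 * (c ^- 2 * Ex Q1 (fun s1 => Ex Q2 (fun s2 => S s1 s2 ^+ 2))
    - 2 / c * (c * mu) + 1))).
  rewrite -(Ex_g phi) -[X in _ - _ * (_ * X)]Ex_mu -!Ex_slice -/Q1 -/Q2.
  apply: (@le_trans _ _ (Ex Q1 (fun s1 => Ex Q2 (fun s2 => 2 / c * A s1 s2 +
    4 * (c ^- 2 * S s1 s2 ^+ 2 - 2 / c * S s1 s2 + 1))))).
    by apply: le_Ex => s1 _; apply: le_Ex => s2 _.
  rewrite le_eqVlt; apply/orP; left; apply/eqP.
  transitivity (Ex Q1 (fun s1 => 2 / c * Ex Q2 (A s1) +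
     4 * (c ^- 2 * Ex Q2 (fun s2 => S s1 s2 ^+ 2) - 2 / c * Ex Q2 (S s1) + 1))).
    apply: eq_Ex => s1; rewrite ExD !ExZ; congr (_ + 4 * _).
    by rewrite !ExD ExN !ExZ Ex_cst.
  by rewrite ExD !ExZ; congr (_ + 4 * _); rewrite !ExD ExN !ExZ Ex_cst.
apply: lerD; first by rewrite mulrA divfK ?gt_eqF.
rewrite ler_pM2l //.
have -> : 2 / c * (c * mu) = 2 * mu by field; rewrite gt_eqF.
have : c ^- 2 * Ex Q1 (fun s1 => Ex Q2 (fun s2 => S s1 s2 ^+ 2)) <=
   `|G12| / c + `|G1| / J1%:R + `|G2| / J2%:R + mu ^+ 2.
  apply: (@le_trans _ _ (c ^- 2 * (c * `|G12| + J1%:R * J2%:R ^+ 2 * `|G1| +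
    J1%:R ^+ 2 * J2%:R * `|G2| + J1%:R ^+ 2 * J2%:R ^+ 2 * mu ^+ 2))).
    by apply: ler_wpM2l => //; rewrite invr_ge0 exprn_ge0 // ltW.
  rewrite le_eqVlt; apply/orP; left; apply/eqP; rewrite /c.
  by field; rewrite !gt_eqF.
(* This turns the remainder [mu ^+ 2 - 2 * mu + 1] into [1 - mu]. *)
have : mu ^+ 2 <= mu by rewrite expr2 -[leRHS]mulr1 ler_wpM2l.
by lra.
Qed.

End MutualCovering.

(** * One-shot coding *)

Section Packing.
Variables (R : realType) (V Y Z : finType) (q : fdist R V) (M J : nat).
Variables (D : V -> Y -> bool) (pr : Z -> Y) (k : R).
Hypothesis Dk : forall y, Ex q (fun v => (D v y)%:R) <= k.

(** Non-unique decoding: any codeword of a bin may pass the test, since only the message matters. *)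
Definition threshold_dec (m0 : 'I_M) (c : 'I_M -> {ffun 'I_J -> V}) (y : Y)
  : 'I_M := odflt m0 [pick m | [exists j, D (c m j) y]].

(** The union bound over foreign codewords, kept as a count so that its mean is a plain sum. *)
Definition confusions (c : 'I_M -> {ffun 'I_J -> V}) (m : 'I_M) (y : Y) : R :=
  \sum_(m' | m' != m) \sum_j (D (c m' j) y)%:R.

Lemma confusions_ge0 c m y : 0 <= confusions c m y.
Proof. by apply: sumr_ge0 => m' _; apply: sumr_ge0 => j _; apply: ler0n. Qed.

(** A wrong answer means that a wrong bin passed, which is counted, or that no bin passed, and then
    every codeword of the true bin failed. The index [j] stays free for the encoder to choose. *)
Lemma threshold_dec_err m0 c m j y :
  (threshold_dec m0 c y != m)%:R <= (~~ D (c m j) y)%:R + confusions c m y.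
Proof.
rewrite /threshold_dec; case: pickP => [m' /existsP[j' Dm']|no] /=.
  have [_|m'm] := eqVneq m' m; first by rewrite addr_ge0 // confusions_ge0.
  rewrite -[leLHS]add0r lerD // /confusions (bigD1 m') //= (bigD1 j') //= Dm'.
  rewrite -addrA lerDl addr_ge0 ?sumr_ge0 // => l _.
  by apply: sumr_ge0 => *; apply: ler0n.
have /existsPn/(_ j) -> := negbT (no m).
apply: ler_wpDr; first exact: confusions_ge0.
by rewrite ler_nat leq_b1.
Qed.

(** The law of [z] depends on the codebook only through the bin [c m], which is independent of all
    other bins. Each of the [M.-1 * J] foreign codewords therefore passes with probability at most
    [k]. *)
Lemma packing (P : {ffun 'I_J -> V} -> fdist R Z) (m : 'I_M) :
  Ex (prodp (fun=> prodp (fun=> q)))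
    (fun c : {ffun 'I_M -> {ffun 'I_J -> V}} =>
       Ex (P (c m)) (fun z => confusions c m (pr z))) <=
  M.-1%:R * J%:R * k.
Proof.
have k0 (m' : 'I_M) : 'I_J -> Z -> 0 <= k.
  by move=> _ z; apply: le_trans (Dk (pr z)); apply: Ex_ge0.
set Q := prodp (fun=> q).
apply: (@le_trans _ _ (\sum_z \sum_(m' | m' != m) \sum_(j < J)
    (Ex Q (fun s => P s z) * k))).
  rewrite /Ex; under eq_bigr do rewrite mulr_sumr.
  rewrite exchange_big; apply: ler_sum => z _.
  under eq_bigr do rewrite /confusions !mulr_sumr.
  rewrite exchange_big; apply: ler_sum => m' mm'.
  under eq_bigr do rewrite !mulr_sumr.
  rewrite exchange_big; apply: ler_sum => j _ /=.
  have := @Ex_coordM R 'I_M _ Q m m' (fun s => P s z)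
    (fun s => (D (s j) (pr z))%:R).
  rewrite /Ex eq_sym => -> //; apply: ler_wpM2l; last first.
    by apply: le_trans (Dk (pr z)); rewrite -(Ex_coord q j).
  by apply: sumr_ge0 => s _; rewrite mulr_ge0 ?pmf_ge0.
rewrite le_eqVlt; apply/orP; left; apply/eqP.
transitivity (\sum_z Ex Q (fun s => P s z) * (M.-1%:R * J%:R * k)).
  apply: eq_bigr => z _; rewrite !sumr_const cardC1 !card_ord.
  rewrite -[LHS]mulr_natl -[X in _ * X]mulr_natl.
  by ring.
rewrite -mulr_suml -Ex_sum (@eq_Ex _ _ _ _ (fun=> 1)) ?Ex_cst ?mul1r // => s.
by rewrite pmf_sum1.
Qed.

End Packing.

(** * Random coding with bins for a single use of the channel *)

Section OneShot.
Variables (R : realType) (W X Y1 Y2 V1 V2 : finType).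
Variables (pw : fdist R W) (pv : W -> fdist R (V1 * V2)%type).
Variables (px : W -> V1 * V2 -> fdist R X) (py : X -> W -> fdist R (Y1 * Y2)%type).
Variables (q1 : fdist R V1) (q2 : fdist R V2).
Variables (M1 M2 J1 J2 : nat).
Hypotheses (M1_gt0 : (0 < M1)%N) (M2_gt0 : (0 < M2)%N).
Hypotheses (J1_gt0 : (0 < J1)%N) (J2_gt0 : (0 < J2)%N).
Variables (D1 : V1 -> Y1 -> bool) (D2 : V2 -> Y2 -> bool) (k1 k2 : R).
Hypotheses (D1k : forall y, Ex q1 (fun v => (D1 v y)%:R) <= k1)
  (D2k : forall y, Ex q2 (fun v => (D2 v y)%:R) <= k2).
Variables (T : W -> V1 -> V2 -> bool) (G12 G1 G2 : R).
Hypotheses (G12_ge0 : 0 <= G12) (G1_ge0 : 0 <= G1) (G2_ge0 : 0 <= G2).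
Hypotheses
  (TG12 : forall w v1 v2, T w v1 v2 -> pv w (v1, v2) <= G12 * (q1 v1 * q2 v2))
  (TG1 : forall w v1 v2, T w v1 v2 -> \sum_v pv w (v1, v) <= G1 * q1 v1)
  (TG2 : forall w v1 v2, T w v1 v2 -> \sum_v pv w (v, v2) <= G2 * q2 v2).

Let missed v1 v2 (y : Y1 * Y2) : bool := ~~ D1 v1 y.1 || ~~ D2 v2 y.2.
Let risk w v1 v2 x : R := Ex (py x w) (fun y => (missed v1 v2 y)%:R).
(** Truncation to [T] provides the density bounds required by mutual covering; the price is the mass
    lost outside [T]. *)
Let a w v1 v2 : R := pv w (v1, v2) * (T w v1 v2)%:R.
Let S1 := {ffun 'I_J1 -> V1}.
Let S2 := {ffun 'I_J2 -> V2}.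
Let Q1 := prodp (fun _ : 'I_J1 => q1).
Let Q2 := prodp (fun _ : 'I_J2 => q2).

Let risk_ge0 w v1 v2 x : 0 <= risk w v1 v2 x.
Proof. by apply: Ex_ge0 => y _; apply: ler0n. Qed.

Let risk_le1 w v1 v2 x : risk w v1 v2 x <= 1.
Proof. by apply: Ex_le1 => y _; rewrite lern1 leq_b1. Qed.

Let a_ge0 w v1 v2 : 0 <= a w v1 v2.
Proof. by rewrite mulr_ge0 ?pmf_ge0. Qed.

Let a_le w v1 v2 : a w v1 v2 <= pv w (v1, v2).
Proof. by rewrite -[leRHS]mulr1 ler_wpM2l ?pmf_ge0 // lern1 leq_b1. Qed.

Let sum_a w : \sum_v1 \sum_v2 a w v1 v2 =
  1 - Ex (pv w) (fun v => (~~ T w v.1 v.2)%:R).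
Proof.
rewrite -[X in X - _](Ex_cst (pv w)) -ExN -ExD /Ex pair_bigA.
apply: eq_bigr => -[v1 v2] _; rewrite /a /=.
by case: (T w v1 v2); rewrite ?subr0 ?subrr.
Qed.

(** Minimising over the input as well as the codewords keeps the encoder deterministic: an average
    over p(x | w, v1, v2) can only be larger. *)
Let optimal_choice :
  exists sel : W -> S1 -> S2 -> 'I_J1 * 'I_J2 * X,
  forall w (s1 : S1) (s2 : S2) j1 j2 x,
    risk w (s1 (sel w s1 s2).1.1) (s2 (sel w s1 s2).1.2) (sel w s1 s2).2 <=
    risk w (s1 j1) (s2 j2) x.
Proof.
(* The three laws show that [X] is inhabited, which supplies the starting point of [arg_min]. *)
have [w0 _] := fdist_supp pw; have [v0 _] := fdist_supp (pv w0).
have [x0 _] := fdist_supp (px w0 v0).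
pose F w (s1 : S1) (s2 : S2) (k : 'I_J1 * 'I_J2 * X) :=
  risk w (s1 k.1.1) (s2 k.1.2) k.2.
exists (fun w s1 s2 => Order.arg_min (Ordinal J1_gt0, Ordinal J2_gt0, x0) predT
  (F w s1 s2)) => w s1 s2 j1 j2 x.
by case: arg_minP => // k _ /(_ (j1, j2, x) isT).
Qed.

Let slack : R := G12 / (J1%:R * J2%:R) + G1 / J1%:R + G2 / J2%:R.

(** Mutual covering for each fixed [w], with [phi] the risk averaged over the input kernel. *)
Let covering (m : W -> S1 -> S2 -> R) :
  (forall w s1 s2, 0 <= m w s1 s2 <= 1) ->
  (forall w (s1 : S1) (s2 : S2) j1 j2 x, m w s1 s2 <= risk w (s1 j1) (s2 j2) x) ->
  Ex pw (fun w => Ex Q1 (fun s1 => Ex Q2 (m w s1))) <=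
  2 * Ex pw (fun w => Ex (pv w) (fun v => Ex (px w v) (risk w v.1 v.2))) +
  4 * (Ex pw (fun w => Ex (pv w) (fun v => (~~ T w v.1 v.2)%:R)) + slack).
Proof.
move=> m01 mr.
rewrite -[slack](Ex_cst pw) -ExD -!ExZ -ExD; apply: le_Ex => w _.
pose phi v1 v2 := Ex (px w (v1, v2)) (risk w v1 v2).
have phi_ge0 v1 v2 : 0 <= phi v1 v2 by apply: Ex_ge0.
have aG12 v1 v2 : a w v1 v2 <= G12 * (q1 v1 * q2 v2).
  rewrite /a; case: (boolP (T w v1 v2)) => [/TG12|_]; rewrite ?mulr1 ?mulr0 //.
  by rewrite !mulr_ge0 ?pmf_ge0.
have aG1 v1 : \sum_v2 a w v1 v2 <= G1 * q1 v1.
  (* The conclusion of [TG1] does not involve [v2], so one typical [v2] yields it; with none, the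
     truncated sum is zero. *)
  have [[v2 Tv]|no] := pselect (exists v2, T w v1 v2).
    by apply: le_trans (TG1 Tv); apply: ler_sum.
  rewrite big1 ?mulr_ge0 ?pmf_ge0 // => v2 _; rewrite /a.
  by case: (boolP (T w v1 v2)) => [Tv|_]; rewrite ?mulr0 //; case: no; exists v2.
have aG2 v2 : \sum_v1 a w v1 v2 <= G2 * q2 v2.
  have [[v1 Tv]|no] := pselect (exists v1, T w v1 v2).
    by apply: le_trans (TG2 Tv); apply: ler_sum.
  rewrite big1 ?mulr_ge0 ?pmf_ge0 // => v1 _; rewrite /a.
  by case: (boolP (T w v1 v2)) => [Tv|_]; rewrite ?mulr0 //; case: no; exists v1.
have a_le1 : \sum_v1 \sum_v2 a w v1 v2 <= 1.
  by rewrite sum_a gerBl; apply: Ex_ge0.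
have mphi s1 s2 j1 j2 : m w s1 s2 <= phi (s1 j1) (s2 j2).
  by rewrite -(Ex_cst (px w (s1 j1, s2 j2)) (m w s1 s2)); apply: le_Ex.
apply: le_trans (mutual_covering J1_gt0 J2_gt0 (a_ge0 w) a_le1 aG12 aG1 aG2
  (m01 w) mphi) _.
rewrite !ger0_norm // lerD //; last first.
  by rewrite sum_a -/slack; lra.
rewrite ler_pM2l // pair_bigA /=; apply: ler_sum => -[v1 v2] _ /=.
by rewrite ler_wpM2r.
Qed.

(** The bound is proved for the mean over independent random codebooks, from which two uses of
    [Ex_attained] fix a good pair. Its three lines of terms come from failed tests, imperfect
    covering and confusions. *)
Lemma one_shot : exists (enc : 'I_M1 -> 'I_M2 -> W -> X) (dec1 : Y1 -> 'I_M1)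
    (dec2 : Y2 -> 'I_M2),
  \sum_m1 \sum_m2 M1%:R^-1 * M2%:R^-1 * Ex pw (fun w =>
    Ex (py (enc m1 m2 w) w) (fun y =>
      ((dec1 y.1 != m1) || (dec2 y.2 != m2))%:R)) <=
  2 * Ex pw (fun w => Ex (pv w) (fun v => Ex (px w v) (fun x =>
        Ex (py x w) (fun y => (~~ D1 v.1 y.1 || ~~ D2 v.2 y.2)%:R)))) +
  4 * (Ex pw (fun w => Ex (pv w) (fun v => (~~ T w v.1 v.2)%:R)) +
    (G12 / (J1%:R * J2%:R) + G1 / J1%:R + G2 / J2%:R)) +
  (M1.-1%:R * J1%:R * k1 + M2.-1%:R * J2%:R * k2).
Proof.
have [sel selP] := optimal_choice.
pose m w (s1 : S1) (s2 : S2) := risk w (s1 (sel w s1 s2).1.1) (s2 (sel w s1 s2).1.2)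
  (sel w s1 s2).2.
have m01 w s1 s2 : 0 <= m w s1 s2 <= 1 by rewrite risk_ge0 risk_le1.
have := covering m01 selP; rewrite -/slack.
set B := 2 * _ + _ => cov; set e := _ + _ * k2.
pose C1 := {ffun 'I_M1 -> S1}; pose C2 := {ffun 'I_M2 -> S2}.
pose QC1 : fdist R C1 := prodp (fun=> Q1).
pose QC2 : fdist R C2 := prodp (fun=> Q2).
pose enc (c1 : C1) (c2 : C2) m1 m2 w := (sel w (c1 m1) (c2 m2)).2.
pose d1 (c1 : C1) := threshold_dec D1 (Ordinal M1_gt0) c1.
pose d2 (c2 : C2) := threshold_dec D2 (Ordinal M2_gt0) c2.
pose err c1 c2 m1 m2 w := Ex (py (enc c1 c2 m1 m2 w) w) (fun y =>
  ((d1 c1 y.1 != m1) || (d2 c2 y.2 != m2))%:R).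
pose avg c1 c2 := \sum_m1 \sum_m2 M1%:R^-1 * M2%:R^-1 * Ex pw (err c1 c2 m1 m2).
suff [c1 /Ex_attained[c2 c12]] : exists c1, Ex QC2 (avg c1) <= B + e.
  by exists (enc c1 c2), (d1 c1), (d2 c2).
apply: (@Ex_attained _ _ QC1).
have errE m1 m2 : Ex QC1 (fun c1 => Ex QC2 (fun c2 => Ex pw (err c1 c2 m1 m2)))
    <= B + e.
  (* Union bound over both users: a chosen codeword fails its own test, with probability [m], or a
     codeword of another message passes. *)
  have pt w c1 c2 : err c1 c2 m1 m2 w <= m w (c1 m1) (c2 m2) +
     (Ex (py (enc c1 c2 m1 m2 w) w) (fun y => confusions R D1 c1 m1 y.1) +
      Ex (py (enc c1 c2 m1 m2 w) w) (fun y => confusions R D2 c2 m2 y.2)).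
    rewrite /m /risk -!ExD; apply: le_Ex => y _; rewrite /missed.
    have union (e1 e2 n1 n2 : bool) (u1 u2 : R) : 0 <= u1 -> 0 <= u2 ->
        e1%:R <= n1%:R + u1 -> e2%:R <= n2%:R + u2 ->
        (e1 || e2)%:R <= (n1 || n2)%:R + (u1 + u2).
      by case: e1 e2 n1 n2 => [] [] [] [] /=; lra.
    by apply: union; rewrite ?confusions_ge0 //; apply: threshold_dec_err.
  have -> : Ex QC1 (fun c1 => Ex QC2 (fun c2 => Ex pw (err c1 c2 m1 m2))) =
      Ex pw (fun w => Ex QC1 (fun c1 => Ex QC2 (fun c2 => err c1 c2 m1 m2 w))).
    rewrite [RHS]Ex_exchange; apply: eq_Ex => c1; exact: Ex_exchange.
  apply: le_trans (lerD cov (lexx e)).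
  rewrite -[e](Ex_cst pw) -ExD; apply: le_Ex => w _.
  apply: (@le_trans _ _ (Ex QC1 (fun c1 => Ex QC2 (fun c2 =>
     m w (c1 m1) (c2 m2) +
     (Ex (py (enc c1 c2 m1 m2 w) w) (fun y => confusions R D1 c1 m1 y.1) +
      Ex (py (enc c1 c2 m1 m2 w) w) (fun y => confusions R D2 c2 m2 y.2)))))).
    by apply: le_Ex => c1 _; apply: le_Ex => c2 _; apply: pt.
  under eq_Ex do rewrite !ExD.
  rewrite !ExD; apply: lerD; last apply: lerD.
  - rewrite le_eqVlt; apply/orP; left; apply/eqP.
    rewrite -(Ex_coord Q1 m1 (fun s1 => Ex Q2 (m w s1))).
    by apply: eq_Ex => c1; rewrite (Ex_coord Q2 m2 (m w (c1 m1))).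
  (* With [c2] frozen, the output law depends on [c1] only through the sent bin [c1 m1], as
     [packing] requires. *)
  - rewrite Ex_exchange -[leRHS](Ex_cst QC2); apply: le_Ex => c2 _.
    exact: (@packing _ _ _ _ q1 M1 J1 D1 fst k1 D1k
      (fun s => py (sel w s (c2 m2)).2 w) m1).
  - rewrite -[leRHS](Ex_cst QC1); apply: le_Ex => c1 _.
    exact: (@packing _ _ _ _ q2 M2 J2 D2 snd k2 D2k
      (fun s => py (sel w (c1 m1) s).2 w) m2).
have -> : Ex QC1 (fun c1 => Ex QC2 (avg c1)) = \sum_m1 \sum_m2 M1%:R^-1 * M2%:R^-1
   * Ex QC1 (fun c1 => Ex QC2 (fun c2 => Ex pw (err c1 c2 m1 m2))).
  transitivity (Ex QC1 (fun c1 => \sum_m1 \sum_m2 M1%:R^-1 * M2%:R^-1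
     * Ex QC2 (fun c2 => Ex pw (err c1 c2 m1 m2)))).
    apply: eq_Ex => c1; rewrite Ex_sum; apply: eq_bigr => m1 _.
    by rewrite Ex_sum; apply: eq_bigr => m2 _; rewrite ExZ.
  rewrite Ex_sum; apply: eq_bigr => m1 _.
  by rewrite Ex_sum; apply: eq_bigr => m2 _; rewrite ExZ.
apply: (@le_trans _ _ (\sum_(m1 < M1) \sum_(m2 < M2) M1%:R^-1 * M2%:R^-1 * (B + e))).
  apply: ler_sum => m1 _; apply: ler_sum => m2 _.
  by rewrite ler_wpM2l // mulr_ge0 ?invr_ge0.
rewrite !sumr_const !card_ord.
rewrite -[leLHS]mulr_natl -[X in _ * X <= _]mulr_natl le_eqVlt.
apply/orP; left; apply/eqP.
by field; rewrite !pnatr_eq0 -!lt0n M1_gt0 M2_gt0.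
Qed.

End OneShot.

(** * Likelihood ratios and mutual information *)

Section PowersOfTwo.
Variable R : realType.
Implicit Types x y e : R.

Lemma ln2_gt0 : 0 < ln 2 :> R.
Proof. by rewrite ln_gt0 // ltr1n. Qed.

Lemma pow2_gt0 x : 0 < 2 `^ x.
Proof. by rewrite powR_gt0. Qed.

Lemma pow2D x y : 2 `^ (x + y) = 2 `^ x * 2 `^ y.
Proof. by rewrite powRD // pnatr_eq0 implybT. Qed.

Lemma ler_pow2 x y : (2 `^ x <= 2 `^ y) = (x <= y).
Proof. by rewrite /powR pnatr_eq0 /= ler_expR ler_pM2r // ln2_gt0. Qed.

Lemma pow2_log2 x : 0 < x -> 2 `^ (log2 x) = x.
Proof.
move=> x0; rewrite /powR pnatr_eq0 /= /log2 divfK ?lnK ?posrE //.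
by rewrite gt_eqF // ln2_gt0.
Qed.

Lemma log2M x y : 0 < x -> 0 < y -> log2 (x * y) = log2 x + log2 y.
Proof. by move=> x0 y0; rewrite /log2 lnM ?posrE // mulrDl. Qed.

Lemma log2V x : 0 < x -> log2 x^-1 = - log2 x.
Proof. by move=> x0; rewrite /log2 lnV ?posrE // mulNr. Qed.

Lemma log2_le x : 0 < x -> log2 x <= (x - 1) / ln 2.
Proof.
move=> x0; rewrite ler_pM2r ?invr_gt0 ?ln2_gt0 //.
have {1}-> : x = 1 + (x - 1) by rewrite addrC subrK.
by apply: le_ln1Dx; rewrite ltrBrDl subrr.
Qed.

Lemma pow2_sum (I : finType) (f : I -> R) :
  2 `^ (\sum_i f i) = \prod_i 2 `^ (f i).
Proof. by apply: (big_morph _ pow2D); rewrite powRr0. Qed.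

Lemma cvg_pow2_decay e : 0 < e -> 2 `^ (- (N%:R * e)) @[N --> \oo] --> (0 : R).
Proof.
move=> e0; have := @cvg_geometric R 1 (2 `^ (- e)).
have -> : geometric 1 (2 `^ (- e)) = fun N => 2 `^ (- (N%:R * e)).
  apply/funext => N /=.
  by rewrite mul1r -powR_mulrn ?powR_ge0 // -powRrM mulrC mulrN.
apply; rewrite ger0_norm ?powR_ge0 // -[ltRHS](powRr0 2) ltNge ler_pow2 -ltNge.
by rewrite oppr_lt0.
Qed.

Lemma nmsg_ge N r : 2 `^ (N%:R * r) <= (nmsg N r)%:R :> R.
Proof.
rewrite /nmsg natr_absz; apply: le_trans (ceil_ge _) _.
by rewrite ler_int ler_norm.
Qed.

Lemma nmsg_gt0 N (r : R) : (0 < nmsg N r)%N.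
Proof. by rewrite -(ltr0n R); apply: lt_le_trans (nmsg_ge N r); apply: pow2_gt0. Qed.

Lemma nmsg_lt N r : (nmsg N r)%:R < 2 `^ (N%:R * r) + 1 :> R.
Proof.
have c0 : (0 : int) <= Num.ceil (2 `^ (N%:R * r) : R).
  by rewrite ceil_ge0 (lt_trans _ (pow2_gt0 _)) // ltrN10.
rewrite /nmsg natr_absz ger0_norm // -ltrBlDr.
by have := ceilB1_lt (2 `^ (N%:R * r) : R); rewrite intrD.
Qed.

(** Rounding up adds less than one message, so the number of wrong messages needs no constant
    factor. *)
Lemma nmsg_pred_le N r : (nmsg N r).-1%:R <= 2 `^ (N%:R * r) :> R.
Proof.
have := nmsg_lt N r; rewrite -{1}(prednK (nmsg_gt0 N r)) -natr1 ltrD2r.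
exact: ltW.
Qed.

(** For [r >= 0] the power is at least 1, so adding 1 at most doubles it. *)
Lemma nmsg_le N r : 0 <= r -> (nmsg N r)%:R <= 2 * 2 `^ (N%:R * r) :> R.
Proof.
move=> r0; have : 1 <= 2 `^ (N%:R * r) :> R.
  by rewrite -[leLHS](powRr0 2) ler_pow2 mulr_ge0.
by have := nmsg_lt N r; lra.
Qed.

Lemma nmsg0 N : nmsg N (0 : R) = 1%N.
Proof. by rewrite /nmsg mulr0 powRr0 ceil1. Qed.

End PowersOfTwo.

(** * Tails of likelihood ratios and mutual information as a mean *)

Section InformationTail.
Variables (R : realType) (T : finType) (p : fdist R T).

(* The weak law of large numbers for log2 (a / b), whose mean is mu. *)
Lemma cvg_ratio_tail (a b : T -> R) (mu e : R) : 0 < e ->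
  (forall t, 0 < p t -> 0 < a t) -> (forall t, 0 < p t -> 0 < b t) ->
  Ex p (fun t => log2 (a t / b t)) = mu ->
  Pr (prodp (fun _ : 'I_N => p)) (fun f =>
    2 `^ (N%:R * (mu + e)) * \prod_n b (f n) <= \prod_n a (f n))
    @[N --> \oo] --> (0 : R).
Proof.
move=> e0 a0 b0 hmu; pose h t := log2 (a t / b t).
set V := Ex p (fun t => (h t - mu) ^+ 2) / e ^+ 2.
apply: (@squeeze_cvgr _ _ _ _ (fun=> 0) (fun N => V * N%:R^-1)).
- exists 1%N => // N N1; apply/andP; split; first exact: Pr_ge0.
  apply: le_trans (weak_law e0 N1 (esym hmu)).
  rewrite !Pr_Ex; apply: le_Ex => f pf.
  rewrite ler_nat; case: (boolP (_ <= \prod_n a (f n))) => //.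
  have ab n : 0 < a (f n) / b (f n).
    by have := prodp_supp n pf => pn; rewrite divr_gt0 ?a0 ?b0.
  have -> : \prod_n a (f n) = 2 `^ (\sum_n h (f n)) * \prod_n b (f n).
    rewrite pow2_sum -big_split; apply: eq_bigr => n _ /=.
    rewrite pow2_log2 // divfK // gt_eqF // b0 //; exact: prodp_supp pf.
  rewrite ler_pM2r ?ler_pow2 => [->//|].
  by apply: prodr_gt0 => n _; apply: b0; apply: prodp_supp pf.
- exact: cvg_cst.
- rewrite -[X in _ --> X](mulr0 V); apply: cvgMr.
  by rewrite -cvg_shiftS; apply: cvg_harmonic.
Qed.

Section MutualInformation.
Variables (S U : finType) (A : T -> S) (B : T -> U).

(** Mutual information as the mean of the information density, the form to which the weak law
    applies. *)
Lemma mutual_info_Ex : mutual_info p A B = Ex p (fun t =>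
  log2 (Pr p (fun u => (A u == A t) && (B u == B t)) /
    (Pr p (fun u => A u == A t) * Pr p (fun u => B u == B t)))).
Proof.
by rewrite (Ex_comp2 p A B (fun a b => log2 (Pr p (fun u => (A u == a) && (B u == b)) /
    (Pr p (fun u => A u == a) * Pr p (fun u => B u == b))))).
Qed.

Lemma sum_Pr : \sum_s Pr p (fun t => A t == s) = 1.
Proof.
rewrite -[RHS](Ex_cst p) (Ex_comp p A (fun=> 1)).
by apply: eq_bigr => s _; rewrite mulr1.
Qed.

End MutualInformation.

(** Gibbs' inequality: the tangent bound on the logarithm is applied to the inverse density ratio,
    whose mean is at most 1 because it sums the product of the marginals over the support of the
    joint law. *)
Lemma mutual_info_ge0 (S U : finType) (A : T -> S) (B : T -> U) :
  0 <= mutual_info p A B.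
Proof.
pose PA a := Pr p (fun u => A u == a); pose PB b := Pr p (fun u => B u == b).
pose PAB a b := Pr p (fun u => (A u == a) && (B u == b)).
rewrite mutual_info_Ex -oppr_le0 -ExN.
apply: (@le_trans _ _ (Ex p (fun t =>
   (PA (A t) * PB (B t) / PAB (A t) (B t) - 1) / ln 2))).
  apply: le_Ex => t pt.
  have A0 : 0 < PA (A t) by apply: Pr_gt0 pt _.
  have B0 : 0 < PB (B t) by apply: Pr_gt0 pt _.
  have AB0 : 0 < PAB (A t) (B t) by apply: Pr_gt0 pt _; rewrite !eqxx.
  rewrite -log2V ?divr_gt0 ?mulr_gt0 // invf_div; apply: log2_le.
  by rewrite divr_gt0 ?mulr_gt0.
rewrite ExZr ExD Ex_cst pmulr_lle0 ?invr_gt0 ?ln2_gt0 // subr_le0.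
rewrite (Ex_comp2 p A B (fun a b => PA a * PB b / PAB a b)).
apply: (@le_trans _ _ (\sum_a \sum_b PA a * PB b)).
  apply: ler_sum => a _; apply: ler_sum => b _; rewrite -/(PAB a b).
  have [->|ab] := eqVneq (PAB a b) 0; first by rewrite mul0r mulr_ge0 ?Pr_ge0.
  by rewrite mulrCA mulrA mulfK.
by under eq_bigr do rewrite -mulr_sumr sum_Pr mulr1; rewrite sum_Pr.
Qed.

End InformationTail.

(** * Single-letter and n-letter laws *)

Section UserDecoder.
Variables (R : realType) (T V Y : finType) (p : fdist R T).
Variables (A : T -> V) (B : T -> Y).

Definition marginal : fdist R V := FDist (fun v => Pr_ge0 p _) (sum_Pr p A).

Let PB y := Pr p (fun t => B t == y).
Let PAB v y := Pr p (fun t => (A t == v) && (B t == y)).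
Let I := mutual_info p A B.

Let sum_PAB y : \sum_v PAB v y = PB y.
Proof.
rewrite /PAB /PB /Pr [RHS](partition_big A predT) //=; apply: eq_bigr => v _.
by apply: eq_bigl => t; rewrite andbC.
Qed.

Let sum_prod_PAB N (y : {ffun 'I_N -> Y}) :
  \sum_(v : {ffun 'I_N -> V}) \prod_n PAB (v n) (y n) = \prod_n PB (y n).
Proof.
rewrite -(bigA_distr_bigA (fun n v => PAB v (y n))).
by apply: eq_bigr => n _; rewrite sum_PAB.
Qed.

(** Tests whether the information density of the block exceeds [z], with denominators cleared;
    strictness rejects blocks where both sides vanish. *)
Let passes (z : R) N (v : {ffun 'I_N -> V}) (y : {ffun 'I_N -> Y}) : bool :=
  2 `^ z * \prod_n (marginal (v n) * PB (y n)) < \prod_n PAB (v n) (y n).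

(** Change of measure: given [y] the codeword has conditional law [r v / b], and on passing blocks
    the product of marginals is at most 2 to the power [- z] times that law. *)
Let passes_le (z : R) N (y : {ffun 'I_N -> Y}) :
  Ex (prodp (fun=> marginal)) (fun v => (passes z v y)%:R) <= 2 `^ (- z).
Proof.
set b := \prod_n PB (y n); pose r (v : {ffun 'I_N -> V}) := \prod_n PAB (v n) (y n).
have r0 v : 0 <= r v by apply: prodr_ge0 => n _; apply: Pr_ge0.
have [b0|b0] := eqVneq b 0.
  have rE v : r v = 0.
    have : \sum_v r v = 0 by rewrite sum_prod_PAB.
    move=> /eqP; rewrite psumr_eq0 // => /allP/(_ v).
    by rewrite mem_index_enum => /(_ isT)/eqP.
  apply: (@le_trans _ _ 0); last by rewrite powR_ge0.
  rewrite -[leRHS](Ex_cst (prodp (fun _ : 'I_N => marginal))); apply: le_Ex => v _.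
  by rewrite /passes -/(r v) rE big_split /= -/b b0 !mulr0 ltxx.
have bp : 0 < b by rewrite lt0r b0 prodr_ge0 // => n _; apply: Pr_ge0.
have -> : 2 `^ (- z) = \sum_v 2 `^ (- z) * (r v / b).
  by rewrite -mulr_sumr -mulr_suml sum_prod_PAB divff // mulr1.
apply: ler_sum => v _; rewrite /passes big_split /= -/b -/(r v).
case: ltP => [lt|_]; last by rewrite mulr0 mulr_ge0 ?powR_ge0 ?divr_ge0 // ltW.
rewrite mulr1 mulrA ler_pdivlMr // powRN mulrC -[X in _ <= X]mulrC.
rewrite ler_pdivlMr ?pow2_gt0 //; apply: le_trans (ltW lt).
by rewrite le_eqVlt; apply/orP; left; apply/eqP; ring.
Qed.

(** The threshold lies [N%:R * e] below the mean density, so the weak law makes misses rare. Of the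
    margin [2 * e], this spends one [e]; the other makes the confusions decay exponentially. *)
Lemma user_decoder (r r' e : R) : 0 < e -> 0 <= r' ->
    r = 0 \/ r + r' + 2 * e <= I ->
  exists (D : forall N, {ffun 'I_N -> V} -> {ffun 'I_N -> Y} -> bool)
      (k : nat -> R),
  [/\ forall N y, Ex (prodp (fun=> marginal)) (fun v => (D N v y)%:R) <= k N,
      Pr (prodp (fun _ : 'I_N => p)) (fun f =>
        ~~ D N [ffun n => A (f n)] [ffun n => B (f n)]) @[N --> \oo] --> (0 : R) &
      (nmsg N r).-1%:R * (nmsg N r')%:R * k N @[N --> \oo] --> (0 : R)].
Proof.
move=> e0 r'0 [->|rI].
  (* At rate zero there is a single message, so a test that always accepts never misses and
     [(nmsg N 0).-1] kills the confusion term. *)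
  exists (fun _ _ _ => true), (fun=> 1); split.
  - by move=> N y; rewrite Ex_cst.
  - rewrite (_ : (fun N => _) = fun=> 0); first exact: cvg_cst.
    by apply/funext => N; rewrite Pr_Ex Ex_cst.
  - rewrite (_ : (fun N => _) = fun=> 0); first exact: cvg_cst.
    by apply/funext => N; rewrite nmsg0 !mul0r.
exists (fun N => passes (N%:R * (I - e)) (N := N)).
exists (fun N => 2 `^ (- (N%:R * (I - e)))).
split => [N y||].
- exact: passes_le.
(* The tail bound controls large ratios, while a miss is a small density; hence the inverted ratio,
   of mean [- I]. *)
- have tail := @cvg_ratio_tail R T p (fun t => marginal (A t) * PB (B t))
    (fun t => PAB (A t) (B t)) (- I) e e0.
  apply: cvg_trans (tail _ _ _) => /=; last first.
  + rewrite /I mutual_info_Ex -ExN; apply: eq_Ex_supp => t pt.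
    rewrite -log2V; first by rewrite invf_div.
    by rewrite divr_gt0 ?mulr_gt0 //; apply: Pr_gt0 pt _; rewrite ?eqxx.
  + by move=> t pt; apply: Pr_gt0 pt _; rewrite ?eqxx.
  + by move=> t pt; rewrite mulr_gt0 //; apply: Pr_gt0 pt _; rewrite ?eqxx.
  rewrite (_ : (fun N => _) = (fun N => Pr (prodp (fun _ : 'I_N => p)) (fun f =>
    2 `^ (N%:R * (- I + e)) * \prod_n PAB (A (f n)) (B (f n)) <=
    \prod_n (marginal (A (f n)) * PB (B (f n)))))) //.
  apply/funext => N; apply: eq_bigl => f; rewrite /passes -leNgt.
  have -> : N%:R * (- I + e) = - (N%:R * (I - e)) by ring.
  rewrite powRN ler_pdivrMl ?pow2_gt0 //.
  by congr (_ <= 2 `^ _ * _); apply: eq_bigr => n _; rewrite !ffunE.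
- apply: (@squeeze_cvgr _ _ _ _ (fun=> 0) (fun N => 2 * 2 `^ (- (N%:R * e)))).
  + near=> N; rewrite !mulr_ge0 ?powR_ge0 //=.
    apply: (@le_trans _ _ (2 `^ (N%:R * r) * (2 * 2 `^ (N%:R * r')) *
      2 `^ (- (N%:R * (I - e))))).
      rewrite ler_pM2r ?pow2_gt0 //; apply: ler_pM => //.
        exact: nmsg_pred_le.
      exact: nmsg_le.
    rewrite mulrCA -!mulrA ler_pM2l // -!pow2D ler_pow2.
    have : N%:R * (r + r' + 2 * e) <= N%:R * I by rewrite ler_wpM2l.
    by lra.
  + exact: cvg_cst.
  + rewrite -[X in _ --> X](mulr0 2); apply: cvgMr; exact: cvg_pow2_decay.
Unshelve. all: by end_near.
Qed.

End UserDecoder.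

Lemma sum_pair (R : realType) (S T : finType) (F : S * T -> R) :
  \sum_z F z = \sum_s \sum_t F (s, t).
Proof. by rewrite pair_bigA; apply: eq_bigr => -[]. Qed.

(** * The joint law generated by the kernels, for one letter and for blocks *)

Section Joint.
Variables (R : realType) (W X Y1 Y2 V1 V2 : finType) (C : channel R W X Y1 Y2).
Variables (p : fdist R (sample W X Y1 Y2 V1 V2)).
Variables (qV : W -> fdist R (V1 * V2)%type) (qX : W -> V1 -> V2 -> fdist R X).
Hypothesis pE : forall w v1 v2 x y1 y2, p (w, v1, v2, x, y1, y2) =
  state_law C w * qV w (v1, v2) * qX w v1 v2 x * trans_law C x w (y1, y2).

Lemma Ex_sample (F : W -> V1 -> V2 -> X -> Y1 -> Y2 -> R) :
  Ex p (fun s => F (rvW s) (rvV1 s) (rvV2 s)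
    (let: (_, _, _, x, _, _) := s in x) (rvY1 s) (rvY2 s)) =
  Ex (state_law C) (fun w => Ex (qV w) (fun v => Ex (qX w v.1 v.2) (fun x =>
    Ex (trans_law C x w) (fun y => F w v.1 v.2 x y.1 y.2)))).
Proof.
rewrite /Ex 5!sum_pair; apply: eq_bigr => w _; rewrite sum_pair mulr_sumr.
apply: eq_bigr => v1 _; rewrite mulr_sumr; apply: eq_bigr => v2 _ /=.
rewrite mulrA mulr_sumr; apply: eq_bigr => x _; rewrite mulrA sum_pair mulr_sumr.
apply: eq_bigr => y1 _; rewrite mulr_sumr; apply: eq_bigr => y2 _ /=.
by rewrite pE -!mulrA.
Qed.

(** Drawing a block kernel by kernel amounts to drawing i.i.d. samples of [p]. This turns the terms
    of the one-shot bound into probabilities to which the weak law applies. *)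
Lemma Ex_samples N (F : {ffun 'I_N -> W} -> {ffun 'I_N -> V1} ->
    {ffun 'I_N -> V2} -> {ffun 'I_N -> Y1} -> {ffun 'I_N -> Y2} -> R) :
  Ex (prodp (fun=> state_law C)) (fun w => Ex (zprod (fun n => qV (w n))) (fun v =>
    Ex (prodp (fun n => qX (w n) (v.1 n) (v.2 n))) (fun x =>
    Ex (zprod (fun n => trans_law C (x n) (w n))) (fun y =>
      F w v.1 v.2 y.1 y.2)))) =
  Ex (prodp (fun _ : 'I_N => p)) (fun f =>
    F [ffun n => rvW (f n)] [ffun n => rvV1 (f n)] [ffun n => rvV2 (f n)]
      [ffun n => rvY1 (f n)] [ffun n => rvY2 (f n)]).
Proof.
rewrite /Ex 5!sum_ffzip; apply: eq_bigr => w _; rewrite sum_pair mulr_sumr.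
apply: eq_bigr => v1 _; rewrite mulr_sumr; apply: eq_bigr => v2 _ /=.
rewrite mulrA mulr_sumr; apply: eq_bigr => x _; rewrite mulrA sum_pair mulr_sumr.
apply: eq_bigr => y1 _; rewrite mulr_sumr; apply: eq_bigr => y2 _ /=.
rewrite mulrA -!big_split /=; congr (_ * _).
  by apply: eq_bigr => n _; rewrite !ffunE pE.
by congr (F _ _ _ _ _); apply/ffunP => n; rewrite !ffunE.
Qed.

Lemma Ex_sampleWV (F : W -> V1 -> V2 -> R) :
  Ex p (fun s => F (rvW s) (rvV1 s) (rvV2 s)) =
  \sum_w \sum_v1 \sum_v2 state_law C w * qV w (v1, v2) * F w v1 v2.
Proof.
rewrite (Ex_sample (fun w v1 v2 _ _ _ => F w v1 v2)); apply: eq_bigr => w _.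
rewrite /Ex sum_pair mulr_sumr; apply: eq_bigr => v1 _.
rewrite mulr_sumr; apply: eq_bigr => v2 _ /=.
by rewrite -[\sum_x _]/(Ex _ _) (eq_Ex _ (fun x => Ex_cst _ _)) Ex_cst mulrA.
Qed.

Let sum_delta (S : finType) (s0 : S) (F : S -> R) :
  \sum_s F s * (s == s0)%:R = F s0.
Proof.
rewrite (bigD1 s0) //= eqxx mulr1 big1 ?addr0 // => s /negbTE ->.
by rewrite mulr0.
Qed.

Lemma PrW w : Pr p (fun s => rvW s == w) = state_law C w.
Proof.
rewrite Pr_Ex (Ex_sampleWV (fun w' _ _ => (w' == w)%:R)).
rewrite -[RHS](sum_delta w (state_law C)); apply: eq_bigr => w' _.
rewrite -[state_law C w' in RHS]mulr1 -(pmf_sum1 (qV w')) sum_pair mulr_sumr mulr_suml.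
by apply: eq_bigr => v1 _; rewrite mulr_sumr mulr_suml.
Qed.

Lemma PrV12W w v1 v2 : Pr p (fun s => (rvV12 s == (v1, v2)) && (rvW s == w)) =
  state_law C w * qV w (v1, v2).
Proof.
rewrite Pr_Ex (Ex_sampleWV (fun w' u1 u2 => (((u1, u2) == (v1, v2)) && (w' == w))%:R)).
rewrite -(sum_delta w (fun w => state_law C w * qV w (v1, v2))); apply: eq_bigr => w' _.
rewrite -(sum_delta v1 (fun v1 => state_law C w' * qV w' (v1, v2))) mulr_suml.
apply: eq_bigr => u1 _.
rewrite -(sum_delta v2 (fun v2 => state_law C w' * qV w' (u1, v2))) !mulr_suml.
apply: eq_bigr => u2 _.
rewrite xpair_eqE.
by case: eqP; case: eqP; case: eqP; rewrite /= ?(mulr0, mul0r, mulr1).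
Qed.

Lemma PrV1W w v1 : Pr p (fun s => (rvV1 s == v1) && (rvW s == w)) =
  state_law C w * \sum_v2 qV w (v1, v2).
Proof.
rewrite Pr_Ex (Ex_sampleWV (fun w' u1 u2 => ((u1 == v1) && (w' == w))%:R)).
rewrite -(sum_delta w (fun w => state_law C w * \sum_v2 qV w (v1, v2))).
apply: eq_bigr => w' _.
rewrite -(sum_delta v1 (fun v1 => state_law C w' * \sum_v2 qV w' (v1, v2))).
rewrite mulr_suml; apply: eq_bigr => u1 _.
rewrite mulr_sumr !mulr_suml; apply: eq_bigr => u2 _.
by rewrite -!mulrA -!natrM !mulnb.
Qed.

Lemma PrV2W w v2 : Pr p (fun s => (rvV2 s == v2) && (rvW s == w)) =
  state_law C w * \sum_v1 qV w (v1, v2).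
Proof.
rewrite Pr_Ex (Ex_sampleWV (fun w' u1 u2 => ((u2 == v2) && (w' == w))%:R)).
rewrite -(sum_delta w (fun w => state_law C w * \sum_v1 qV w (v1, v2))).
apply: eq_bigr => w' _.
rewrite mulr_sumr mulr_suml; apply: eq_bigr => u1 _.
rewrite -(sum_delta v2 (fun v2 => state_law C w' * qV w' (u1, v2))) mulr_suml.
apply: eq_bigr => u2 _.
by rewrite -!mulrA -!natrM !mulnb.
Qed.

End Joint.

(** * Coding theorem *)

(** Both error events lie in the event that some user errs, so one bound serves the maximum. *)
Lemma error_prob_le (R : realType) (W X Y1 Y2 : finType)
    (C : channel R W X Y1 Y2) (M1 M2 N : nat) (c : code W X Y1 Y2 M1 M2 N) :
  error_prob C c <= \sum_m1 \sum_m2 M1%:R^-1 * M2%:R^-1 *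
    Ex (prodp (fun=> state_law C)) (fun w =>
      Ex (zprod (fun n => trans_law C (enc c m1 m2 w n) (w n))) (fun y =>
        ((dec1 c y.1 != m1) || (dec2 c y.2 != m2))%:R)).
Proof.
rewrite /error_prob ge_max; apply/andP; split.
all: rewrite /error1 /error2 /Pr big_mkcond /= /outcome 4!sum_pair.
all: apply: ler_sum => m1 _; apply: ler_sum => m2 _.
all: rewrite mulr_sumr; apply: ler_sum => w _.
all: rewrite /Ex sum_pair !mulr_sumr; apply: ler_sum => y1 _.
all: rewrite !mulr_sumr; apply: ler_sum => y2 _ /=.
all: have w0 : 0 <= \prod_(n < N) state_law C (w n)
  by apply: prodr_ge0 => n _; apply: pmf_ge0.
all: have y0 : 0 <= \prod_(n < N) trans_law C (enc c m1 m2 w n) (w n) (y1 n, y2 n)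
  by apply: prodr_ge0 => n _; apply: pmf_ge0.
all: case: ifP => [bad|_]; last by rewrite !mulr_ge0 ?invr_ge0.
all: rewrite (_ : _ || _ = true) ?mulr1 ?mulrA //.
all: by apply/orP; first [by left | by right].
Qed.

Section CodingTheorem.
Variables (R : realType) (W X Y1 Y2 V1 V2 : finType) (C : channel R W X Y1 Y2).
Variables (p : fdist R (sample W X Y1 Y2 V1 V2)).
Variables (qV : W -> fdist R (V1 * V2)%type) (qX : W -> V1 -> V2 -> fdist R X).
Hypothesis pE : forall w v1 v2 x y1 y2, p (w, v1, v2, x, y1, y2) =
  state_law C w * qV w (v1, v2) * qX w v1 v2 x * trans_law C x w (y1, y2).

Notation q1 := (marginal p (@rvV1 W X Y1 Y2 V1 V2)).
Notation q2 := (marginal p (@rvV2 W X Y1 Y2 V1 V2)).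
Notation Info A B := (mutual_info p (A W X Y1 Y2 V1 V2) (B W X Y1 Y2 V1 V2)).
Let I12 := Info (@rvV1) (@rvV2) + Info (@rvV12) (@rvW).

Let q1_gt0 s : 0 < p s -> 0 < q1 (rvV1 s).
Proof. by move=> ps; apply: Pr_gt0 ps _; apply: eqxx. Qed.

Let q2_gt0 s : 0 < p s -> 0 < q2 (rvV2 s).
Proof. by move=> ps; apply: Pr_gt0 ps _; apply: eqxx. Qed.

Let st_gt0 s : 0 < p s -> 0 < state_law C (rvW s).
Proof. by move=> ps; rewrite -(PrW pE); apply: Pr_gt0 ps _; apply: eqxx. Qed.

Let qV_gt0 s : 0 < p s -> 0 < qV (rvW s) (rvV1 s, rvV2 s).
Proof.
move=> ps; rewrite -(pmulr_rgt0 _ (st_gt0 ps)) -(PrV12W pE).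
by apply: Pr_gt0 ps _; rewrite !eqxx.
Qed.

Let qV1_gt0 s : 0 < p s -> 0 < \sum_v2 qV (rvW s) (rvV1 s, v2).
Proof.
move=> ps; rewrite -(pmulr_rgt0 _ (st_gt0 ps)) -(PrV1W pE).
by apply: Pr_gt0 ps _; rewrite !eqxx.
Qed.

Let qV2_gt0 s : 0 < p s -> 0 < \sum_v1 qV (rvW s) (v1, rvV2 s).
Proof.
move=> ps; rewrite -(pmulr_rgt0 _ (st_gt0 ps)) -(PrV2W pE).
by apply: Pr_gt0 ps _; rewrite !eqxx.
Qed.

(** The density ratios of I(V1; V2) and I(V1, V2; W) multiply to this ratio, the joint law of (V1,
    V2) cancelling. *)
Let info12 : Ex p (fun s => log2 (qV (rvW s) (rvV1 s, rvV2 s) /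
  (q1 (rvV1 s) * q2 (rvV2 s)))) = I12.
Proof.
rewrite /I12 !mutual_info_Ex -ExD; apply: eq_Ex_supp => s ps.
rewrite -[rvV12 s]/(rvV1 s, rvV2 s).
rewrite -[Pr p (fun u => rvV1 u == rvV1 s)]/(q1 (rvV1 s)).
rewrite -[Pr p (fun u => rvV2 u == rvV2 s)]/(q2 (rvV2 s)).
have P12 : 0 < Pr p (fun u => rvV12 u == (rvV1 s, rvV2 s)).
  by apply: Pr_gt0 ps _; rewrite eqxx.
have -> : Pr p (fun u => (rvV1 u == rvV1 s) && (rvV2 u == rvV2 s)) =
    Pr p (fun u => rvV12 u == (rvV1 s, rvV2 s)).
  by apply: eq_bigl => u; rewrite xpair_eqE.
rewrite (PrV12W pE) (PrW pE) -log2M.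
- congr log2; have := st_gt0 ps; have := q1_gt0 ps; have := q2_gt0 ps => a b c.
  by field; rewrite !gt_eqF.
- by rewrite divr_gt0 // mulr_gt0 //; [exact: q1_gt0|exact: q2_gt0].
- have := st_gt0 ps => c; rewrite divr_gt0 // mulr_gt0 //; exact: qV_gt0.
Qed.

Let info1 : Ex p (fun s => log2 ((\sum_v2 qV (rvW s) (rvV1 s, v2)) / q1 (rvV1 s)))
  = Info (@rvV1) (@rvW).
Proof.
rewrite mutual_info_Ex; apply: eq_Ex_supp => s ps.
rewrite (PrV1W pE) (PrW pE); congr log2.
rewrite -[Pr p (fun u => rvV1 u == rvV1 s)]/(q1 (rvV1 s)).
by have := st_gt0 ps; have := q1_gt0 ps => a b; field; rewrite !gt_eqF.
Qed.

Let info2 : Ex p (fun s => log2 ((\sum_v1 qV (rvW s) (v1, rvV2 s)) / q2 (rvV2 s)))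
  = Info (@rvV2) (@rvW).
Proof.
rewrite mutual_info_Ex; apply: eq_Ex_supp => s ps.
rewrite (PrV2W pE) (PrW pE); congr log2.
rewrite -[Pr p (fun u => rvV2 u == rvV2 s)]/(q2 (rvV2 s)).
by have := st_gt0 ps; have := q2_gt0 ps => a b; field; rewrite !gt_eqF.
Qed.

(** Of the margin [2 * e], one [e] pays for the typicality threshold and the other remains as
    exponential decay. *)
Let slack_le N (a b e : R) (J : nat) : 2 `^ (N%:R * b) <= J%:R ->
  a + 2 * e <= b -> 2 `^ (N%:R * (a + e)) / J%:R <= 2 `^ (- (N%:R * e)).
Proof.
move=> Jb ab; have J0 : 0 < J%:R :> R by apply: lt_le_trans Jb; apply: pow2_gt0.
rewrite ler_pdivrMr //.
apply: (@le_trans _ _ (2 `^ (- (N%:R * e)) * 2 `^ (N%:R * b))); last first.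
  by rewrite ler_pM2l ?pow2_gt0.
rewrite -pow2D ler_pow2.
have : N%:R * (a + 2 * e) <= N%:R * b by rewrite ler_wpM2l.
by lra.
Qed.

(** [r1'] and [r2'] are the bin rates. The three lower bounds on them are covering conditions; the
    two disjunctions are packing conditions, from which a user of rate zero is exempt. *)
Lemma marton_gelfand_pinsker (r1 r2 r1' r2' e : R) :
  0 < e -> 0 <= r1 -> 0 <= r2 -> 0 <= r1' -> 0 <= r2' ->
  Info (@rvV1) (@rvW) + 2 * e <= r1' -> Info (@rvV2) (@rvW) + 2 * e <= r2' ->
  Info (@rvV1) (@rvV2) + Info (@rvV12) (@rvW) + 2 * e <= r1' + r2' ->
  r1 = 0 \/ r1 + r1' + 2 * e <= Info (@rvV1) (@rvY1) ->
  r2 = 0 \/ r2 + r2' + 2 * e <= Info (@rvV2) (@rvY2) ->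
  achievable C (r1, r2).
Proof.
move=> e0 r10 r20 r1'0 r2'0 cov1 cov2 cov12 pack1 pack2; split => //=.
have [D1 [k1 [D1k miss1 conf1]]] := user_decoder e0 r1'0 pack1.
have [D2 [k2 [D2k miss2 conf2]]] := user_decoder e0 r2'0 pack2.
have b12_gt0 s : 0 < p s -> 0 < q1 (rvV1 s) * q2 (rvV2 s).
  by move=> ps; rewrite mulr_gt0 // ?q1_gt0 ?q2_gt0.
have tail12 := cvg_ratio_tail e0 qV_gt0 b12_gt0 info12.
have tail1 := cvg_ratio_tail e0 qV1_gt0 q1_gt0 info1.
have tail2 := cvg_ratio_tail e0 qV2_gt0 q2_gt0 info2.
set m1 := (fun N => Pr _ _) in miss1; set m2 := (fun N => Pr _ _) in miss2.
set c1 := (fun N => _) in conf1; set c2 := (fun N => _) in conf2.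
set t12 := (fun N => Pr _ _) in tail12; set t1 := (fun N => Pr _ _) in tail1.
set t2 := (fun N => Pr _ _) in tail2.
pose d N := 2 `^ (- (N%:R * e)) : R.
(* The one-shot bound term by term: misses, atypical blocks, three covering slacks of size [d N],
   confusions. *)
pose bound N := 2 * (m1 N + m2 N) + 4 * (t12 N + t1 N + t2 N + (d N + d N + d N))
  + (c1 N + c2 N).
have bound0 : bound N @[N --> \oo] --> (0 : R).
  have dc : d N @[N --> \oo] --> (0 : R) := cvg_pow2_decay e0.
  have -> : 0 = 2 * (0 + 0) + 4 * (0 + 0 + 0 + (0 + 0 + 0)) + (0 + 0) :> R by ring.
  apply: cvgD; last exact: cvgD.
  apply: cvgD; apply: cvgMr; first exact: cvgD.
  by apply: cvgD; apply: cvgD => //; apply: cvgD.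
suff codes N : exists c : code W X Y1 Y2 (nmsg N r1) (nmsg N r2) N,
    error_prob C c <= bound N.
  exists (fun N => projT1 (cid (codes N))).
  apply: (@squeeze_cvgr _ _ _ _ (fun=> 0) bound) => //; last exact: cvg_cst.
  near=> N; rewrite (projT2 (cid (codes N))) andbT /error_prob le_max; apply/orP; left.
  apply: sumr_ge0 => -[[[[i1 i2] w] y1] y2] _.
  by rewrite !mulr_ge0 ?invr_ge0 // prodr_ge0 // => n _; apply: pmf_ge0.
(* Joint typicality: three likelihood ratios, each with exponent at most [e] per letter above its
   mean. Failures are covered by the tail events of [t12], [t1] and [t2]. *)
pose T (w : {ffun 'I_N -> W}) (v1 : {ffun 'I_N -> V1}) (v2 : {ffun 'I_N -> V2}) :=
  [&& \prod_n qV (w n) (v1 n, v2 n) <= 2 `^ (N%:R * (I12 + e)) *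
        ((\prod_n q1 (v1 n)) * \prod_n q2 (v2 n)),
      \prod_n (\sum_u qV (w n) (v1 n, u)) <=
        2 `^ (N%:R * (Info (@rvV1) (@rvW) + e)) * \prod_n q1 (v1 n) &
      \prod_n (\sum_u qV (w n) (u, v2 n)) <=
        2 `^ (N%:R * (Info (@rvV2) (@rvW) + e)) * \prod_n q2 (v2 n)].
have TG12 w v1 v2 : T w v1 v2 -> zprod (fun n => qV (w n)) (v1, v2) <=
    2 `^ (N%:R * (I12 + e)) * (prodp (fun=> q1) v1 * prodp (fun=> q2) v2).
  by case/and3P.
have TG1 w v1 v2 : T w v1 v2 -> \sum_u zprod (fun n => qV (w n)) (v1, u) <=
    2 `^ (N%:R * (Info (@rvV1) (@rvW) + e)) * prodp (fun=> q1) v1.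
  (* The marginal of a product kernel is the product of the marginals. *)
  case/and3P => _ + _; rewrite (bigA_distr_bigA (fun n u => qV (w n) (v1 n, u))).
  exact.
have TG2 w v1 v2 : T w v1 v2 -> \sum_u zprod (fun n => qV (w n)) (u, v2) <=
    2 `^ (N%:R * (Info (@rvV2) (@rvW) + e)) * prodp (fun=> q2) v2.
  case/and3P => _ _; rewrite (bigA_distr_bigA (fun n u => qV (w n) (u, v2 n))).
  exact.
(* A whole block is treated as one letter, so the encoder sees the entire state sequence,
   noncausally. *)
have [enc [dec1 [dec2 errle]]] := one_shot (prodp (fun=> state_law C))
  (fun (w : {ffun 'I_N -> W}) (v : {ffun 'I_N -> V1} * {ffun 'I_N -> V2}) =>
     prodp (fun n => qX (w n) (v.1 n) (v.2 n)))
  (fun (x : {ffun 'I_N -> X}) (w : {ffun 'I_N -> W}) =>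
     zprod (fun n => trans_law C (x n) (w n)))
  (nmsg_gt0 N r1) (nmsg_gt0 N r2) (nmsg_gt0 N r1') (nmsg_gt0 N r2')
  (D1k N) (D2k N) (powR_ge0 _ _) (powR_ge0 _ _) (powR_ge0 _ _) TG12 TG1 TG2.
exists (Code enc dec1 dec2); apply: le_trans (error_prob_le C _) _.
apply: le_trans errle _; apply: lerD => //; apply: lerD.
  rewrite ler_pM2l //.
  rewrite (Ex_samples pE (fun _ v1 v2 y1 y2 =>
    (~~ D1 N v1 y1 || ~~ D2 N v2 y2)%:R)).
  rewrite /m1 /m2 !Pr_Ex -ExD; apply: le_Ex => f _.
  by rewrite -natrD ler_nat; do 2 case: (~~ _).
rewrite ler_pM2l //; apply: lerD.
  (* [T] ignores input and outputs; averages of a constant are inserted to reach the nested form of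
     [Ex_samples]. *)
  have -> : Ex (prodp (fun=> state_law C)) (fun w => Ex (zprod (fun n => qV (w n)))
      (fun v => (~~ T w v.1 v.2)%:R)) = Ex (prodp (fun _ : 'I_N => p)) (fun f =>
      (~~ T [ffun n => rvW (f n)] [ffun n => rvV1 (f n)] [ffun n => rvV2 (f n)])%:R).
    rewrite -(Ex_samples pE (fun w v1 v2 _ _ => (~~ T w v1 v2)%:R)).
    apply: eq_Ex => w; apply: eq_Ex => v; rewrite -[LHS](Ex_cst (prodp
      (fun n => qX (w n) (v.1 n) (v.2 n)))); apply: eq_Ex => x.
    by rewrite Ex_cst.
  rewrite /t12 /t1 /t2 !Pr_Ex -!ExD; apply: le_Ex => f _.
  have eqW (x y : R) : x = y -> x <= y by move->.
  have union (b1 b2 b3 e1 e2 e3 : bool) : (b1 -> e1) -> (b2 -> e2) -> (b3 -> e3) ->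
      (b1 || (b2 || b3))%:R <= e1%:R + e2%:R + e3%:R :> R.
    rewrite -!natrD ler_nat.
    case: b1 => [/(_ isT)->|_]; case: b2 => [/(_ isT)->|_];
      case: b3 => [/(_ isT)->|_] //=; by case: e1; case: e2; case: e3.
  rewrite /T !negb_and -!ltNge; apply: union => /ltW lt.
  - apply: le_trans (le_trans _ lt) _; apply: eqW; last first.
      by apply: eq_bigr => n _; rewrite !ffunE.
    by rewrite big_split; congr (_ * (_ * _)); apply: eq_bigr => n _; rewrite !ffunE.
  - apply: le_trans (le_trans _ lt) _; apply: eqW; last first.
      by apply: eq_bigr => n _; rewrite !ffunE.
    by congr (_ * _); apply: eq_bigr => n _; rewrite !ffunE.
  - apply: le_trans (le_trans _ lt) _; apply: eqW; last first.
      by apply: eq_bigr => n _; rewrite !ffunE.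
    by congr (_ * _); apply: eq_bigr => n _; rewrite !ffunE.
apply: lerD; first apply: lerD.
- rewrite -natrM; apply: (slack_le (b := r1' + r2')) => //.
  by rewrite natrM mulrDr pow2D ler_pM ?powR_ge0 ?nmsg_ge.
- exact: slack_le (nmsg_ge N r1') cov1.
- exact: slack_le (nmsg_ge N r2') cov2.
Unshelve. all: by end_near.
Qed.

(** Elimination of the bin rates: after a positive rate is lowered slightly, its bin rate is set as
    large as packing allows, and the constraints on [r] then yield the covering conditions. *)
Lemma rate_constraints_approx (r : R * R) (d : R) : 0 < d ->
  rate_constraints p r ->
  exists a b, [/\ achievable C (a, b), `|r.1 - a| < d & `|r.2 - b| < d].
Proof.
case: r => r1 r2 d0 [/= r10 r20 le1 le2 le12].
have W1 := mutual_info_ge0 p (@rvV1 W X Y1 Y2 V1 V2) (@rvW W X Y1 Y2 V1 V2).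
have W2 := mutual_info_ge0 p (@rvV2 W X Y1 Y2 V1 V2) (@rvW W X Y1 Y2 V1 V2).
have V12 := mutual_info_ge0 p (@rvV1 W X Y1 Y2 V1 V2) (@rvV2 W X Y1 Y2 V1 V2).
have V12W := mutual_info_ge0 p (@rvV12 W X Y1 Y2 V1 V2) (@rvW W X Y1 Y2 V1 V2).
have small (x y : R) : 0 < x -> 0 < y -> exists z, [/\ 0 < z, z < x & z < y].
  move=> x0 y0; exists (Num.min x y / 2).
  have m0 : 0 < Num.min x y by rewrite lt_min x0.
  have mx : Num.min x y <= x by rewrite ge_min lexx.
  have my : Num.min x y <= y by rewrite ge_min lexx orbT.
  by split; lra.
move: le1 le2 le12 W1 W2 V12 V12W.
move: (@marton_gelfand_pinsker).
set w1 := Info (@rvV1) (@rvW); set w2 := Info (@rvV2) (@rvW).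
set i1 := Info (@rvV1) (@rvY1); set i2 := Info (@rvV2) (@rvY2).
set v12 := Info (@rvV1) (@rvV2); set v12w := Info (@rvV12) (@rvW).
move=> coding le1 le2 le12 W1 W2 V12 V12W.
(* A user of rate zero decodes nothing, so its covering rate is unconstrained. *)
have [r1z|r1p] := leP r1 0; have [r2z|r2p] := leP r2 0.
- exists 0, 0; split; last 2 first.
  + by rewrite subr0 ger0_norm //; lra.
  + by rewrite subr0 ger0_norm //; lra.
  (* Each bin rate adds up all the information terms, so every covering condition holds with the
     margin 2, which is [2 * e] for [e = 1]. *)
  apply: (coding 0 0 (w1 + v12 + v12w + 2) (w2 + v12 + v12w + 2) 1);
    first [lra | by left | by right; lra].
- have [z [z0 zd zr]] := small d r2 d0 r2p.
  exists 0, (r2 - z); split; last 2 first.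
  + by rewrite subr0 ger0_norm //; lra.
  + by rewrite opprB addrC subrK gtr0_norm.
  (* The bin rate of user 1 alone meets the joint covering condition; that of user 2 sits exactly at
     its packing limit, with [2 * e = z / 2]. *)
  apply: (coding 0 (r2 - z) (w1 + v12 + v12w + z / 2) (i2 - (r2 - z) - z / 2) (z / 4));
    first [lra | by left | by right; lra].
- have [z [z0 zd zr]] := small d r1 d0 r1p.
  exists (r1 - z), 0; split; last 2 first.
  + by rewrite opprB addrC subrK gtr0_norm.
  + by rewrite subr0 ger0_norm //; lra.
  apply: (coding (r1 - z) 0 (i1 - (r1 - z) - z / 2) (w2 + v12 + v12w + z / 2) (z / 4));
    first [lra | by left | by right; lra].
- have [y [y0 yd yr]] := small d r1 d0 r1p; have [z [z0 zy zr]] := small y r2 y0 r2p.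
  exists (r1 - z), (r2 - z); split; last 2 first.
  + by rewrite opprB addrC subrK gtr0_norm //; lra.
  + by rewrite opprB addrC subrK gtr0_norm //; lra.
  (* Lowering both rates frees [2 * z] in the sum constraint; the two packing margins take [z] and
     the joint covering margin [z / 2]. *)
  apply: (coding (r1 - z) (r2 - z) (i1 - (r1 - z) - z / 2) (i2 - (r2 - z) - z / 2)
    (z / 4));
    first [lra | by left | by right; lra].
Qed.

End CodingTheorem.

(** For fixed [p] every constraint is a non-strict affine inequality in the rates. *)
Lemma rate_constraints_convex (R : realType) (W X Y1 Y2 V1 V2 : finType)
    (p : fdist R (sample W X Y1 Y2 V1 V2)) :
  @convex_set R (R^o * R^o)%type (rate_constraints p).
Proof.
move=> [x1 x2] [y1 y2] l; rewrite !inE => -[/= x10 x20 xle1 xle2 xle12].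
move=> [/= y10 y20 yle1 yle2 yle12].
have [t0 t1] : 0 <= l%:num /\ 0 <= 1 - l%:num by rewrite subr_ge0 ge0 le1.
set t := l%:num in t0 t1.
have convle (u v c : R) : u <= c -> v <= c -> t * u + (1 - t) * v <= c.
  move=> uc vc; have -> : c = t * c + (1 - t) * c by ring.
  by rewrite lerD ?ler_wpM2l.
have convge (u v : R) : 0 <= u -> 0 <= v -> 0 <= t * u + (1 - t) * v.
  by move=> u0 v0; rewrite addr_ge0 ?mulr_ge0.
change (rate_constraints p (t * x1 + (1 - t) * y1, t * x2 + (1 - t) * y2)).
split => /=; [exact: convge|exact: convge|exact: convle|exact: convle|].
apply: le_trans (convle _ _ _ xle12 yle12); rewrite le_eqVlt; apply/orP; left.
by apply/eqP; ring.
Qed.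

Theorem theorem3p1 (R : realType) (W X Y1 Y2 : finType)
    (C1 : channel R W X Y1 Y2) :
  R1in C1 `<=` capacity_region C1.
Proof.
move=> r [V1 [V2 [p [[qV [qX pE]]]]]].
rewrite /R1in_at /convex_hull => hull.
have {hull}: rate_constraints p r.
  (* The hull lies in every convex set containing the rate set, in particular in the rate set
     itself. *)
  by apply: hull; split => //; apply: rate_constraints_convex.
move=> rc B /nbhs_ballP[d /= d0 dB].
have [a [b [ab ra rb]]] := rate_constraints_approx pE d0 rc.
by exists (a, b); split => //; apply: dB; split.
Qed.
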